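(* Let $N\geq 3$, $0<R\leq\infty$, and let $W$ be a smooth function on $(0,R)$. Then $$\int_{B_{R}}|\Delta u|^{2}\,dx\geq\int_{B_{R}}W(|x|)\,|u|^{2}\,dx\quad\text{for all }u\in C_{0}^{\infty}(B_{R}\setminus\{0\})$$ if and only if $$\int_{B_{R}}|\Delta u|^{2}\,dx\geq\int_{B_{R}}W(|x|)\,|u|^{2}\,dx\quad\text{for all radial functions }u\in C_{0}^{\infty}(B_{R}\setminus\{0\}).$$
   Context: $B_R$ is the open ball of radius $R$ centered at the origin in $\mathbb{R}^N$ (with $B_\infty=\mathbb{R}^N$). $C_0^\infty(\Omega)$ is the space of smooth functions with compact support in $\Omega$. The function $W$ is not assumed to have a sign. *)

(* Defs.v *)
From HB Require Import structures.
From mathcomp Require Import all_boot all_order all_algebra.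
From mathcomp Require Import all_classical all_reals all_analysis.

Set Implicit Arguments.
Unset Strict Implicit.
Unset Printing Implicit Defensive.
Import Order.TTheory GRing.Theory Num.Theory.
Import numFieldNormedType.Exports.

Local Open Scope classical_set_scope.
Local Open Scope ring_scope.

Definition measure_rV_display : measure_display.
Proof. exact: default_measure_display. Qed.

(* The sigma-algebra generated by the coordinates, as the library does for
   tuples: this is the Borel sigma-algebra of K^n. *)
Section measurable_rV.
Context {K : realType}.
Variable n : nat.

Let coors : 'I_n -> 'rV[K]_n -> measurableTypeR K := fun i x => x ord0 i.

Let rV_set0 : g_sigma_preimage coors set0.
Proof. exact: sigma_algebra0. Qed.

Let rV_setC A : g_sigma_preimage coors A -> g_sigma_preimage coors (~` A).
Proof. exact: sigma_algebraC. Qed.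

Let rV_bigcup (F : _^nat) : (forall i, g_sigma_preimage coors (F i)) ->
  g_sigma_preimage coors (\bigcup_i (F i)).
Proof. exact: sigma_algebra_bigcup. Qed.

HB.instance Definition _ := @isMeasurable.Build measure_rV_display
  'rV[K]_n (g_sigma_preimage coors) rV_set0 rV_setC rV_bigcup.

Lemma measurable_rV_coord (i : 'I_n) :
  measurable_fun [set: 'rV[K]_n] (fun x => x ord0 i : measurableTypeR K).
Proof.
move=> _ Y mY; rewrite setTI; apply: sub_sigma_algebra => /=.
rewrite -bigcup_seq/=; exists i => /=; first by rewrite mem_index_enum.
by exists Y => //; rewrite setTI.
Qed.

Lemma measurable_fun_rVP d (T : measurableType d) (f : T -> 'rV[K]_n) :
  measurable_fun [set: T] f <->
  forall i, measurable_fun [set: T] (fun t => f t ord0 i : measurableTypeR K).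
Proof.
split=> [mf i|mf].
  exact: (measurableT_comp (@measurable_rV_coord i) mf).
move=> _ A mA; rewrite setTI.
suff : @measurable _ 'rV[K]_n `<=` [set B | measurable (f @^-1` B)] by exact.
apply: smallest_sub.
  split; first by rewrite /= preimage_set0.
    by move=> B /= mB; rewrite setTD preimage_setC; exact: measurableC.
  by move=> F mF; rewrite /= preimage_bigcup; exact: bigcupT_measurable.
rewrite -bigcup_seq => B [i _ [Y mY <-]] /=.
by rewrite setTI -[_ @^-1` _]setTI; exact: mf.
Qed.

End measurable_rV.

Section lebesgue_rV.
Context {K : realType}.

Definition cons_rV n (p : measurableTypeR K * 'rV[K]_n) : 'rV[K]_n.+1 :=
  row_mx (const_mx p.1 : 'rV_1) p.2.

Lemma cons_rV0 n p : @cons_rV n p ord0 ord0 = p.1.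
Proof.
by rewrite /cons_rV mxE; case: splitP => [i _|//]; rewrite mxE.
Qed.

Lemma cons_rVS n p i : @cons_rV n p ord0 (lift ord0 i) = p.2 ord0 i.
Proof.
rewrite /cons_rV mxE; case: splitP => [[[]]//|k /eqP].
by rewrite /= eqSS => /eqP/val_inj ->.
Qed.

Lemma measurable_cons_rV n : measurable_fun setT (@cons_rV n).
Proof.
apply/measurable_fun_rVP => i; case: (unliftP ord0 i) => [j|] ->.
  under eq_fun do rewrite cons_rVS.
  exact: (measurableT_comp (measurable_rV_coord j) measurable_snd).
by under eq_fun do rewrite cons_rV0; exact: measurable_fst.
Qed.

Definition uncons_rV n (x : 'rV[K]_n.+1) : measurableTypeR K * 'rV[K]_n :=
  (x ord0 ord0, \row_i x ord0 (lift ord0 i)).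

Lemma cons_rVK n : cancel (@cons_rV n) (@uncons_rV n).
Proof.
move=> [a x]; rewrite /uncons_rV cons_rV0; congr pair.
by apply/rowP => i; rewrite mxE cons_rVS.
Qed.

Lemma uncons_rVK n : cancel (@uncons_rV n) (@cons_rV n).
Proof.
move=> x; apply/rowP => i.
by case: (unliftP ord0 i) => [j|] ->; rewrite ?cons_rVS ?cons_rV0 ?mxE.
Qed.

Lemma measurable_uncons_rV n : measurable_fun setT (@uncons_rV n).
Proof.
apply/measurable_fun_pair; first exact: measurable_rV_coord.
apply/measurable_fun_rVP => i; under eq_fun do rewrite mxE.
exact: measurable_rV_coord.
Qed.

Definition lebesgue_cons n (mu : set 'rV[K]_n -> \bar K) :
    set 'rV[K]_n.+1 -> \bar K :=
  pushforward (lebesgue_measure \x mu)%E (@cons_rV n).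

Section lebesgue_cons_measure.
Variables (n : nat) (mu : {sigma_finite_measure set 'rV[K]_n -> \bar K}).
Let prodmu := (lebesgue_measure \x mu)%E.

Let lebesgue_cons0 : lebesgue_cons mu set0 = 0%E.
Proof. by rewrite /lebesgue_cons /pushforward preimage_set0 measure0. Qed.

Let lebesgue_cons_ge0 A : (0 <= lebesgue_cons mu A)%E.
Proof. exact: (measure_ge0 prodmu). Qed.

Let measurable_preimage_cons (A : set 'rV[K]_n.+1) :
  measurable A -> measurable (@cons_rV n @^-1` A).
Proof.
by move=> mA; rewrite -[X in measurable X]setTI; exact: measurable_cons_rV.
Qed.

Let lebesgue_cons_sigma_additive : semi_sigma_additive (lebesgue_cons mu).
Proof.
move=> F mF tF mUF; rewrite /lebesgue_cons /pushforward preimage_bigcup.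
apply: (measure_semi_sigma_additive (s := prodmu)).
- by move=> i; exact: measurable_preimage_cons.
- apply/trivIsetP => /= i j _ _ ij; rewrite -preimage_setI.
  by move/trivIsetP : tF => /(_ _ _ _ _ ij) ->//; rewrite preimage_set0.
- by rewrite -preimage_bigcup; exact: measurable_preimage_cons.
Qed.

HB.instance Definition _ := isMeasure.Build _ _ _ (lebesgue_cons mu)
  lebesgue_cons0 lebesgue_cons_ge0 lebesgue_cons_sigma_additive.

Let lebesgue_cons_sigma_finite : sigma_finite setT (lebesgue_cons mu).
Proof.
have /sigma_finiteP[F [TF ndF Foo]] := sigma_finiteT (@lebesgue_measure K).
have /sigma_finiteP[G [TG ndG Goo]] := sigma_finiteT mu.
exists (fun k => @uncons_rV n @^-1` (F k `*` G k)).
  rewrite -preimage_bigcup -[LHS](preimage_setT (@uncons_rV n)); congr (_ @^-1` _).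
  apply/esym; rewrite -subTset => -[a x] _.
  have [i _ Fa] : (\bigcup_k F k) a by rewrite -TF.
  have [j _ Gx] : (\bigcup_k G k) x by rewrite -TG.
  exists (maxn i j) => //; split => /=.
  - by move: a Fa; exact/subsetPset/ndF/leq_maxl.
  - by move: x Gx; exact/subsetPset/ndG/leq_maxr.
move=> k; have [mF Fk] := Foo k; have [mG Gk] := Goo k; split.
  rewrite -[X in measurable X]setTI.
  by apply: measurable_uncons_rV => //; exact: measurableX.
rewrite /lebesgue_cons /pushforward -comp_preimage.
rewrite (_ : _ \o _ = id); last by apply/funext => p; exact: cons_rVK.
by rewrite product_measure1E// lte_mul_pinfty// ge0_fin_numE.
Qed.

HB.instance Definition _ := Measure_isSigmaFinite.Build _ _ _ (lebesgue_cons mu)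
  lebesgue_cons_sigma_finite.

End lebesgue_cons_measure.

(* Lebesgue measure on K^n, as the n-fold product of the library's Lebesgue
   measure on the line; the dirac measure is the unit mass of the point K^0. *)
Fixpoint lebesgue_rV n : set 'rV[K]_n -> \bar K :=
  if n is m.+1 then lebesgue_cons (@lebesgue_rV m) else \d_(0 : 'rV[K]_0).

Let lebesgue_rV_ex n :
  exists mu : {sigma_finite_measure set 'rV[K]_n -> \bar K},
    mu = @lebesgue_rV n :> (set _ -> \bar K).
Proof.
elim: n => [|n [mu muE]]; first by exists (\d_(0 : 'rV[K]_0)).
by exists (lebesgue_cons mu); rewrite /= muE.
Qed.

Let lebesgue_rV_set0 n : @lebesgue_rV n set0 = 0%E.
Proof. by have [mu <-] := lebesgue_rV_ex n; exact: measure0. Qed.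

Let lebesgue_rV_ge0 n A : (0 <= @lebesgue_rV n A)%E.
Proof. by have [mu <-] := lebesgue_rV_ex n; exact: measure_ge0. Qed.

Let lebesgue_rV_sigma_additive n : semi_sigma_additive (@lebesgue_rV n).
Proof.
by have [mu <-] := lebesgue_rV_ex n; exact: measure_semi_sigma_additive.
Qed.

HB.instance Definition _ n := isMeasure.Build _ _ _ (@lebesgue_rV n)
  (@lebesgue_rV_set0 n) (@lebesgue_rV_ge0 n) (@lebesgue_rV_sigma_additive n).

Let lebesgue_rV_sigma_finite n : sigma_finite setT (@lebesgue_rV n).
Proof. by have [mu <-] := lebesgue_rV_ex n; exact: sigma_finiteT. Qed.

HB.instance Definition _ n := Measure_isSigmaFinite.Build _ _ _ (@lebesgue_rV n)
  (@lebesgue_rV_sigma_finite n).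

Lemma lebesgue_rV_box n (A : 'I_n -> set (measurableTypeR K)) :
  (forall i, measurable (A i)) ->
  lebesgue_rV [set x | forall i, A i (x ord0 i)] =
  (\prod_(i < n) lebesgue_measure (A i))%E.
Proof.
elim: n A => [|n IH] A mA.
  rewrite big_ord0 /= diracE mem_set//= => -[]//.
have mB : measurable [set x : 'rV[K]_n | forall i, A (lift ord0 i) (x ord0 i)].
  rewrite (_ : [set _ | _] = \bigcap_(i in [set: 'I_n])
      [set x : 'rV[K]_n | A (lift ord0 i) (x ord0 i)]).
    apply: fin_bigcap_measurable => // i _.
    by rewrite -[X in measurable X]setTI; exact: measurable_rV_coord.
  by apply/seteqP; split=> x /= xA i; [move=> _|]; exact: xA.
rewrite big_ord_recl -IH; last by move=> i; exact: mA.
rewrite -product_measure1E; [|exact: mA|exact: mB].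
rewrite [LHS]/= /lebesgue_cons /pushforward; congr (_ _).
apply/seteqP; split=> -[a x] /=.
  by move=> xA; split=> [|i]; [have := xA ord0|have := xA (lift ord0 i)];
    rewrite ?cons_rV0 ?cons_rVS.
move=> [Aa Ax] i; case: (unliftP ord0 i) => [j|] ->.
  by rewrite cons_rVS; exact: Ax.
by rewrite cons_rV0.
Qed.

End lebesgue_rV.
Arguments lebesgue_rV {K} n.

Section smooth_functions.
Context {K : realType}.

(* The Euclidean norm; the library's norm on row vectors is the sup norm. *)
Definition enorm n (x : 'rV[K]_n) : K := Num.sqrt (\sum_(i < n) x ord0 i ^+ 2).

Definition eball n (r : \bar K) : set 'rV[K]_n := [set x | ((enorm x)%:E < r)%E].

(* [partials [:: i1; ..; ik] u] is the iterated partial derivative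
   d_i1 (... (d_ik u)). *)
Definition partials n (s : seq 'I_n) (u : 'rV[K]_n -> K) : 'rV[K]_n -> K :=
  foldr (fun i f => 'D_(delta_mx ord0 i) f) u s.

Definition smooth n (u : 'rV[K]_n -> K) : Prop :=
  forall s : seq 'I_n, continuous (partials s u) /\
    forall i x, derivable (partials s u) x (delta_mx ord0 i).

(* Smoothness on (0, r). A function on (0, r) is represented by any function on
   K; its values outside (0, r) are unconstrained. *)
Definition smooth_on_interval (r : \bar K) (w : K -> K) : Prop :=
  forall (k : nat) (t : K), 0 < t -> (t%:E < r)%E -> derivable (derive1n k w) t 1.

(* The elements of C_0^oo(Omega) are represented by their extension by 0 to
   the whole space. *)
Definition test_function n (Omega : set 'rV[K]_n) (u : 'rV[K]_n -> K) : Prop :=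
  let supp := closure [set x | u x != 0] in
  [/\ smooth u, compact supp & supp `<=` Omega].

Definition laplacian n (u : 'rV[K]_n -> K) (x : 'rV[K]_n) : K :=
  \sum_(i < n) 'D_(delta_mx ord0 i) ('D_(delta_mx ord0 i) u) x.

Definition radial n (u : 'rV[K]_n -> K) : Prop :=
  exists g : K -> K, forall x, u x = g (enorm x).

End smooth_functions.

(* Main.v *)
From HB Require Import structures.
Require Import Defs.
From mathcomp Require Import all_boot all_order all_algebra.
From mathcomp Require Import all_classical all_reals all_analysis.
From mathcomp Require Import measurable_realfun.
From mathcomp Require Import ring lra.
Import Order.TTheory GRing.Theory Num.Theory.
Import numFieldNormedType.Exports.
Local Open Scope classical_set_scope.
Local Open Scope ring_scope.

(** Write [L] for the radial part of the Laplacian, [lap = L + lap_S / |x|^2],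
    and let [u] be a test function of the punctured ball.  For a unit vector
    [w] the function [F_w x = u (|x| w)] is a radial test function, and
    [lap F_w x = (L u) (|x| w)].  The inequality for radial functions therefore
    says that the integral over [x] of [|L u|^2 - W |u|^2] at the point [|x| w]
    is nonnegative for each [w].  Averaging over all directions
    ([polar_integral], [ge0_integral_le_of_rays]) gives
    [int |L u|^2 >= int W |u|^2], and it remains to see that
    [int |lap u|^2 >= int |L u|^2] ([rellich_radial_part]).

    For the last inequality put [E = x . grad] and [A = - lap_S], so that
    [|x|^2 L = E^2 + (n - 2) E] and [|x|^2 lap = |x|^2 L - A].  For the scalar
    product [<f, g>] with weight [|x|^-4] the operator [A] is symmetric,
    nonnegative and commutes with [E], while [E] is antisymmetric up to the
    constant [4 - n].  Expanding the square gives
    [|lap u|^2 = |L u|^2 + <A u, A u> + 2 (n - 4) <u, A u> + 2 <E u, A (E u)>]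
    in integrated form ([total_lap_decomposition]).  For [n >= 4] all the added
    terms are nonnegative.  For [n = 3] one needs the spectral gap
    [<A u, A u> >= 2 <u, A u>] of the sphere ([angular_gap]).  It is obtained in
    Cartesian coordinates: [int |lap u|^2] is also the integral of the squared
    Hessian ([total_lap_sqr]), which pointwise is at least its
    normal-normal and normal-tangential parts plus half the square of its
    tangential trace ([hessian_sqr_ge]); rewritten with [E] and [A], these bounds
    reduce to the gap.

    Everything rests on three facts: partial derivatives of smooth functions
    commute ([derive_comm]), the integral of a partial derivative is zero
    ([integral_pd_eq0]), and integrals scale under dilations
    ([ge0_integral_affine]). *)

Set Implicit Arguments.
Unset Strict Implicit.
Unset Printing Implicit Defensive.

(** * Lebesgue measure under affine maps, and continuous functions *)

Section affine_change_of_variables.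
Context {K : realType}.
Local Notation mu := (@lebesgue_measure K).

Lemma measurable_affine (l c : K) :
  measurable_fun setT ((fun a => l * a + c) : measurableTypeR K -> measurableTypeR K).
Proof.
by apply: measurable_funD => //; exact: measurable_funM.
Qed.

(** The pushforward of Lebesgue measure under [a |-> l * a + c], scaled by [l],
    gives half-open intervals their length, so it is Lebesgue measure. *)
Lemma ge0_integral_affine1 (l c : K) (f : K -> \bar K) : 0 < l ->
  measurable_fun setT (f : measurableTypeR K -> \bar K) -> (forall x, 0 <= f x)%E ->
  (\int[mu]_a f (l * a + c)%R = l^-1%:E * \int[mu]_a f a)%E.
Proof.
move=> l0 mf f0.
pose phi0 : measurableTypeR K -> measurableTypeR K := fun a => l * a + c.
have mphi : measurable_fun setT phi0 by exact: measurable_affine.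
pose phi : {mfun measurableTypeR K >-> measurableTypeR K} :=
  HB.pack phi0 (isMeasurableFun.Build _ _ _ _ phi0 mphi).
pose nn : {nonneg K} := NngNum (ltW l0).
have E A : measurable A -> mu A = mscale nn (pushforward mu phi) A.
  apply: lebesgue_measure_unique => //= _ [[a b]] _ <-.
  rewrite /mscale/= /pushforward.
  have -> : phi @^-1` `]a, b] = `](a - c) / l, (b - c) / l]%classic.
    apply/seteqP; split => x /=; rewrite !in_itv/= /phi0.
      by rewrite ltr_pdivrMr// ler_pdivlMr// mulrC; lra.
    by rewrite ltr_pdivrMr// ler_pdivlMr// mulrC; lra.
  rewrite !lebesgue_measure_itv/= !lte_fin ltr_pM2r ?invr_gt0//.
  rewrite ltrD2r; case: ifP => _; last by rewrite mule0.
  by rewrite -!EFinD -EFinM -mulrBl mulrC divfK ?gt_eqF//; congr EFin; ring.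
have -> : (\int[mu]_a f a = \int[mscale nn (pushforward mu phi)]_a f a)%E.
  rewrite (@eq_measure_integral _ _ _ setT (mscale nn (pushforward mu phi)) mu f)//.
  by move=> A mA _; exact: E.
rewrite ge0_integral_mscale//= muleA -EFinM mulVf ?gt_eqF// mul1e.
by rewrite ge0_integral_pushforward.
Qed.

Lemma measurable_affine_rV n (l : K) (c : 'rV[K]_n) :
  measurable_fun setT ((fun x => l *: x + c) : 'rV[K]_n -> 'rV[K]_n).
Proof.
apply/measurable_fun_rVP => i; under eq_fun do rewrite !mxE.
apply: measurable_funD => //; apply: measurable_funM => //.
exact: measurable_rV_coord.
Qed.

Lemma ge0_integral_lebesgue_rVS n (f : 'rV[K]_n.+1 -> \bar K) :
  measurable_fun setT f -> (forall x, 0 <= f x)%E ->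
  (\int[lebesgue_rV n.+1]_x f x =
   \int[mu]_a \int[lebesgue_rV n]_y f (cons_rV (a, y)))%E.
Proof.
move=> mf f0.
transitivity (\int[pushforward (mu \x lebesgue_rV n) (@cons_rV K n)]_x f x)%E.
  by [].
rewrite ge0_integral_pushforward//; last exact: measurable_cons_rV.
rewrite preimage_setT fubini_tonelli1//=.
by apply: measurableT_comp => //; exact: measurable_cons_rV.
Qed.

Lemma cons_rV_affine n (l : K) (c : 'rV[K]_n.+1) (a : K) (y : 'rV[K]_n) :
  l *: cons_rV (a, y) + c =
  cons_rV (l * a + c ord0 ord0, l *: y + (uncons_rV c).2).
Proof.
apply/rowP => i; rewrite [LHS]mxE [X in X + _]mxE.
case: (unliftP ord0 i) => [j|] ->; first by rewrite !cons_rVS/= !mxE.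
by rewrite !cons_rV0.
Qed.

(** Induction on the dimension: an affine map [x |-> l *: x + c] acts separately
    on the first coordinate and on the others, and Tonelli's theorem reduces
    the claim to dimension one.  It provides both the translation invariance
    behind integration by parts and the dilations behind the averaging over
    rays. *)
Lemma ge0_integral_affine n (l : K) (c : 'rV[K]_n) (f : 'rV[K]_n -> \bar K) :
  0 < l -> measurable_fun setT f -> (forall x, 0 <= f x)%E ->
  (\int[lebesgue_rV n]_x f (l *: x + c)%R =
   (l ^- n)%:E * \int[lebesgue_rV n]_x f x)%E.
Proof.
move=> l0; elim: n c f => [|n IH] c f mf f0.
  rewrite expr0 invr1 mul1e; apply: eq_integral => x _; congr f.
  by apply/rowP => -[].
rewrite !ge0_integral_lebesgue_rVS//; last first.
  exact: (measurableT_comp mf (@measurable_affine_rV n.+1 l c)).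
pose g a := (\int[lebesgue_rV n]_y f (cons_rV (a, y)))%E.
have mfc : measurable_fun setT (f \o @cons_rV K n).
  exact: measurableT_comp mf (@measurable_cons_rV K n).
transitivity (\int[mu]_a ((l ^- n)%:E * g (l * a + c ord0 ord0)%R))%E.
  apply: eq_integral => a _.
  under eq_integral do rewrite cons_rV_affine.
  rewrite (IH _ (fun y => f (cons_rV (_, y))))//.
  exact: (measurableT_comp mfc (pair1_measurable _)).
have mg : measurable_fun setT g.
  have := @measurable_fun_fubini_tonelli_F _ _ (measurableTypeR K) _ K
    (lebesgue_rV n) (f \o @cons_rV K n) mfc.
  by apply => x; exact: f0.
have g0 a : (0 <= g a)%E by apply: integral_ge0.
rewrite ge0_integralZl//; last 2 first.
- by apply: measurableT_comp => //; exact: measurable_affine.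
- by rewrite lee_fin invr_ge0 exprn_ge0// ltW.
by rewrite ge0_integral_affine1// muleA -EFinM -invfM -exprSr.
Qed.

End affine_change_of_variables.

Section continuous_measurable.
Context {K : realType} {n : nat}.

(** The sigma-algebra is generated by the coordinates; an open set belongs to
    it as the countable union of the rational cubes that it contains. *)
Lemma measurable_open_rV (U : set 'rV[K]_n) : open U -> measurable U.
Proof.
move=> oU.
pose B (p : 'rV[rat]_n * rat) : set 'rV[K]_n :=
  [set x | forall i, `|x ord0 i - ratr (p.1 ord0 i)| < ratr p.2].
have mB p : measurable (B p).
  rewrite (_ : B p = \bigcap_(i in [set: 'I_n])
      ((fun x : 'rV[K]_n => x ord0 i) @^-1` ball (ratr (p.1 ord0 i) : K) (ratr p.2))).
    apply: fin_bigcap_measurable => // i _.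
    rewrite -[X in measurable X]setTI; apply: measurable_rV_coord => //.
    exact: measurable_ball.
  apply/seteqP; split=> x /= xB i; first by move=> _; rewrite /= /ball/= distrC; exact: xB.
  by rewrite distrC; apply: xB.
rewrite (_ : U = \bigcup_(p in [set p | B p `<=` U]) B p); last first.
  apply/seteqP; split => [x Ux|x [p pU]]; last exact: pU.
  have /nbhs_ballP[e /= e0 xeU] : nbhs x U by exact: open_nbhs_nbhs.
  have [q /[!in_itv]/= /andP[q0 qe]] : exists q : rat, ratr q \in `]0, (e / 2)[%R.
    by apply: rat_in_itvoo; rewrite divr_gt0.
  have H i : exists r : rat, `|x ord0 i - ratr r| < ratr q.
    have [|r /[!in_itv]/= /andP[r1 r2]] :=
      @rat_in_itvoo K (x ord0 i - ratr q) (x ord0 i + ratr q).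
      by rewrite ltrBlDr -addrA ltrDl addr_gt0.
    by exists r; rewrite ltr_norml; apply/andP; split; lra.
  have [r rP] := choice H.
  exists (\row_i r i, q) => /=; last by move=> i; rewrite mxE.
  move=> y /= yB; apply: xeU.
  split => // i j /=.
  have := rP j; have := yB j; rewrite /= mxE distrC (ord1 i : i = ord0) /ball/= => h1 h2.
  have := ler_normD (x ord0 j - ratr (r j)) (ratr (r j) - y ord0 j).
  by rewrite addrA subrK; lra.
rewrite bigcup_mkcond; apply: countable_bigcupT_measurable => [|p].
  exact: countableP.
by case: ifP.
Qed.

Lemma continuous_measurable_rV (f : 'rV[K]_n -> K) :
  continuous f -> measurable_fun setT (f : _ -> measurableTypeR K).
Proof.
move=> cf; apply: (measurability _ (RGenOpens.measurableE K)).
move=> _ [_ [a [b ->] <-]]; rewrite setTI; apply: measurable_open_rV.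
by apply: open_comp => [x _|]; [exact: cf|exact: interval_open].
Qed.

End continuous_measurable.

(** * Functions of class C^1 and C^2 *)

(** This operator and those built on it are sealed: two iterated derivatives are
    then compared through their indices and arguments, not by unfolding limits. *)
HB.lock Definition pd (K : realType) (n : nat) (i : 'I_n) (f : 'rV[K]_n -> K) :
  'rV[K]_n -> K := 'D_(delta_mx ord0 i) f.
Local Notation "''d_' i f" := (pd i f) (at level 10, i at level 2, f at level 9,
  format "''d_' i  f").

Lemma pdE (K : realType) (n : nat) (i : 'I_n) (f : 'rV[K]_n -> K) :
  'd_i f = 'D_(delta_mx ord0 i) f.
Proof. by rewrite pd.unlock. Qed.

Lemma pdEx (K : realType) (n : nat) (i : 'I_n) (f : 'rV[K]_n -> K) x :
  'd_i f x = 'D_(delta_mx ord0 i) f x.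
Proof. by rewrite pdE. Qed.

Lemma continuous_sumr (K : realType) (T : topologicalType) (I : finType) (F : I -> T -> K) :
  (forall i, continuous (F i)) -> continuous (fun x => \sum_i F i x).
Proof.
move=> cF; apply: continuous_big => //; exact: add_continuous.
Qed.

Lemma continuous_addr (K : realType) (T : topologicalType) (f g : T -> K) :
  continuous f -> continuous g -> continuous (fun x => f x + g x).
Proof. by move=> cf cg x; apply: cvgD; [exact: cf|exact: cg]. Qed.

Section directional.
Context {K : realType} {V : normedModType K}.
Implicit Types (f : V -> K) (x v w : V).

Lemma is_derive_line f x v (t d : K) : is_derive (t *: v + x) v f d ->
  is_derive t 1 (fun s : K => f (s *: v + x)) d.
Proof.
have E : (fun h : K => h^-1 *: (((fun s : K => f (s *: v + x)) \o shift t) (h *: 1)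
                       - f (t *: v + x))) =
         (fun h : K => h^-1 *: ((f \o shift (t *: v + x)) (h *: v) - f (t *: v + x))).
  by apply/funext => h /=; rewrite [h *: 1]mulr1 scalerDl addrA.
by case=> df <-; split; [rewrite /derivable E|rewrite /derive E].
Qed.

Lemma is_derive_translate f x v w d : is_derive (w + x) v f d ->
  is_derive x v (fun y => f (w + y)) d.
Proof.
have E : (fun h : K => h^-1 *: (((fun y => f (w + y)) \o shift x) (h *: v) - f (w + x))) =
         (fun h : K => h^-1 *: ((f \o shift (w + x)) (h *: v) - f (w + x))).
  by apply/funext => h /=; rewrite addrCA.
by case=> df <-; split; [rewrite /derivable E|rewrite /derive E].
Qed.

Lemma MVT_line f x v (h : K) : (forall y, derivable f y v) ->
  exists2 c, `|c| <= `|h| & f (h *: v + x) - f x = h * 'D_v f (c *: v + x).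
Proof.
move=> df.
have fd (t : K) : is_derive t 1 (fun s : K => f (s *: v + x)) ('D_v f (t *: v + x)).
  by apply: is_derive_line; exact: derivableP.
have fc : continuous (fun s : K => f (s *: v + x)).
  by move=> t; have [+ _] := fd t; move/derivable1_diffP/differentiable_continuous.
have [h0|h0|->] := ltgtP h 0; last first.
- by exists 0; rewrite // scale0r add0r subrr mul0r.
- have [c /[!in_itv]/= /andP[c0 ch] E] := MVT h0 (fun t _ => fd t)
    (continuous_subspaceT fc).
  exists c; first by rewrite !gtr0_norm// ltW.
  by move: E; rewrite scale0r add0r subr0 mulrC.
- have [c /[!in_itv]/= /andP[ch c0] E] := MVT h0 (fun t _ => fd t)
    (continuous_subspaceT fc).
  exists c; first by rewrite !ltr0_norm// lerN2 ltW.
  by move: E; rewrite scale0r add0r sub0r mulrN mulrC -opprB => /oppr_inj.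
Qed.

Lemma differentiable_approx f x (L : {linear V -> K}) : continuous L ->
  (forall e, 0 < e -> \forall h \near (0 : V),
    `|f (h + x) - f x - L h| <= e * `|h|) ->
  differentiable f x /\ forall v, 'D_v f x = L v.
Proof.
move=> cL fL.
have step : f \o shift x = cst (f x) + L +o_ 0 id.
  apply/eqaddoP => e e0; apply: filterS (fL e e0) => h.
  suff -> : (f \o shift x - (cst (f x) + L)) h = f (h + x) - f x - L h by [].
  by rewrite -addrA -opprD.
have dE := diff_unique cL step.
have df : differentiable f x by apply/diff_locallyP; rewrite dE.
by split=> // v; rewrite deriveE// dE.
Qed.

End directional.

Section real_inequalities.
Context {K : realType}.
Implicit Types a b c d : K.

Lemma subrBC a b c d : a - b - (c - d) = a - c - (b - d).
Proof. by ring. Qed.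

Lemma double_quarter_lt a : 0 < a -> `|a / 4| + `|a / 4| < a.
Proof. by move=> a0; rewrite gtr0_norm ?divr_gt0//; lra. Qed.

Lemma half_dist_contra a b c : `|c - a| < `|a - b| / 2 ->
  `|c - b| < `|a - b| / 2 -> False.
Proof.
by move=> h1 h2; have := ler_distD c a b; rewrite (distrC a c); lra.
Qed.

End real_inequalities.

Section row_vectors.
Context {K : realType} {n : nat}.
Implicit Types (f g : 'rV[K]_n -> K) (x y : 'rV[K]_n).

Lemma row_near (P : set 'rV[K]_n) x : nbhs x P ->
  exists2 e : K, 0 < e & forall y, (forall i, `|y ord0 i - x ord0 i| < e) -> P y.
Proof.
move=> /nbhs_ballP[e /= e0 eP]; exists e => // y xy; apply: eP; split => // i j.
by rewrite (ord1 i : i = ord0) /ball/= distrC.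
Qed.

Lemma continuous_coord i : continuous (fun x : 'rV[K]_n => x ord0 i).
Proof. by move=> x; apply: coord_continuous. Qed.

Lemma continuous_coordM i (c : K) : continuous (fun x : 'rV[K]_n => x ord0 i * c).
Proof.
move=> x; apply: continuousM; [exact: continuous_coord|exact: cst_continuous].
Qed.

Lemma ler_coord_norm x i : `|x ord0 i| <= `|x|.
Proof. by rewrite [leRHS]/Num.norm/= mx_normrE; apply: (le_bigmax _ _ (ord0, i)). Qed.

(** The increment of [f] along [h] is split into one increment per coordinate
    direction; the mean value theorem turns each into a partial derivative at a
    point close to [x], and continuity of the partial derivatives concludes. *)
Lemma C1_differentiable f x :
  (forall i y, derivable f y (delta_mx ord0 i)) ->
  (forall i, continuous ('d_i f)) ->
  differentiable f x /\ forall v, 'D_v f x = \sum_i v ord0 i * 'd_i f x.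
Proof.
move=> df cf.
pose L (v : 'rV[K]_n) : K := \sum_i v ord0 i * 'd_i f x.
have Llin : linear L.
  move=> a u v; rewrite /L scaler_sumr -big_split/=; apply: eq_bigr => i _.
  by rewrite !mxE mulrDl -mulrA.
pose Lm := GRing.isLinear.Build _ _ _ _ L Llin.
pose LL : {linear 'rV[K]_n -> K} := HB.pack L Lm.
have cL : continuous LL.
  apply: (continuous_sumr (F := fun i (u : 'rV[K]_n) => u ord0 i * 'd_i f x)) => i.
  exact: continuous_coordM.
apply: (@differentiable_approx _ _ f x LL) => // e e0.
have near_x : \forall y \near x, forall i, `|'d_i f y - 'd_i f x| <= e / n.+1%:R.
  apply: (@filter_forall _ _ (fun i y => `|'d_i f y - 'd_i f x| <= e / n.+1%:R) (nbhs x) _) => i.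
  have := cf i x; move=> /cvgrPdist_le/(_ (e / n.+1%:R)).
  by rewrite divr_gt0// => /(_ isT); apply: filterS => y; rewrite distrC.
have [d d0 dP] := row_near near_x.
have : nbhs (0 : 'rV[K]_n) (ball 0 d) by exact: nbhsx_ballx.
apply: filterS => h hd.
have {}hd i : `|h ord0 i| < d.
  by move: hd => [_ /(_ ord0 i)]; rewrite /ball/= mxE sub0r normrN.
pose p k := x + \row_i (if (i < k)%N then h ord0 i else 0).
have pS (i : 'I_n) : p i.+1 = h ord0 i *: delta_mx ord0 i + p i.
  apply/rowP => j; rewrite !mxE eqxx/= ltnS leq_eqVlt (inj_eq val_inj) eq_sym.
  have [->|ij] := eqVneq i j; first by rewrite ltnn/= mulr1 addr0 addrC.
  by rewrite mulr0 add0r.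
have E : f (h + x) - f x = \sum_(i < n) (f (p i.+1) - f (p i)).
  rewrite -(big_mkord xpredT (fun k => f (p k.+1) - f (p k))) telescope_sumr//.
  congr (f _ - f _).
    by apply/rowP => j; rewrite !mxE ltn_ord addrC.
  by apply/rowP => j; rewrite !mxE addr0.
rewrite E -[LL h]/(L h) /L -sumrB.
apply: le_trans (ler_norm_sum _ _ _) _.
apply: (@le_trans _ _ (\sum_(i < n) `|h| * (e / n.+1%:R))); last first.
  rewrite sumr_const card_ord -mulrnAr -mulr_natr mulrC ler_wpM2r//.
  by rewrite -mulrA ger_pMr// mulrC ler_pdivrMr// mul1r ler_nat.
apply: ler_sum => i _.
have [c ch] := MVT_line (p i) (h ord0 i) (df i); rewrite -pS -pdEx => ->.
rewrite -mulrBr normrM ler_pM// ?ler_coord_norm//; apply: dP => j.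
rewrite !mxE eqxx/=; have [->|ij] := eqVneq j i.
  by rewrite ltnn mulr1 addr0 addrK (le_lt_trans ch).
by rewrite mulr0 add0r addrC addrK; case: ifP => _; rewrite ?normr0.
Qed.

(** Both mixed derivatives are limits of the same second difference quotient,
    which by two applications of the mean value theorem is a value of either
    mixed derivative at a nearby point. *)
Lemma derive_comm f x i j :
  (forall k y, derivable f y (delta_mx ord0 k)) ->
  (forall k l y, derivable ('d_l f) y (delta_mx ord0 k)) ->
  (forall k l, continuous ('d_k ('d_l f))) ->
  'd_i ('d_j f) x = 'd_j ('d_i f) x.
Proof.
move=> df ddf cf.
have second_difference (k l : 'I_n) (s : K) : exists y,
    (forall m, `|y ord0 m - x ord0 m| <= `|s| + `|s|) /\
    (f (s *: delta_mx ord0 l + (s *: delta_mx ord0 k + x))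
     - f (s *: delta_mx ord0 k + x) - (f (s *: delta_mx ord0 l + x) - f x)
     = s * (s * 'd_l ('d_k f) y)).
  pose g y := f (s *: delta_mx ord0 l + y) - f y.
  have dg y : is_derive y (delta_mx ord0 k : 'rV[K]_n) g
      ('d_k f (s *: delta_mx ord0 l + y) - 'd_k f y).
    rewrite !pdEx; apply: is_deriveB; last exact: derivableP.
    by apply: is_derive_translate; exact: derivableP.
  have [c cs] := MVT_line x s (fun y => @ex_derive _ _ _ _ _ _ _ (dg y)).
  rewrite (@derive_val _ _ _ _ _ _ _ (dg _)) /g => ->.
  have [d ds] := MVT_line (c *: delta_mx ord0 k + x) s (ddf l k).
  rewrite -pdEx => ->.
  exists (d *: delta_mx ord0 l + (c *: delta_mx ord0 k + x)); split=> // m.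
  rewrite !mxE addrA addrK (le_trans (ler_normD _ _))//.
  rewrite !normrM lerD// -[leRHS]mulr1 ler_pM//;
    by case: (_ && _); rewrite ?normr0 ?normr1.
apply/eqP/negPn/negP => neq.
pose r : K := `|'d_i ('d_j f) x - 'd_j ('d_i f) x|.
have r0 : 0 < r by rewrite /r normr_gt0 subr_eq0.
have near_x k l : exists2 d : K, 0 < d & forall y,
    (forall m, `|y ord0 m - x ord0 m| < d) ->
    `|'d_k ('d_l f) y - 'd_k ('d_l f) x| < r / 2.
  apply: row_near; have := cf k l x; move=> /cvgrPdist_lt/(_ (r / 2)).
  rewrite divr_gt0// => /(_ isT); apply: filterS => y xy.
  rewrite distrC; exact: xy.
have [d1 d10 d1P] := near_x i j; have [d2 d20 d2P] := near_x j i.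
pose s := Num.min d1 d2 / 4.
have md1 : Num.min d1 d2 <= d1 by rewrite ge_min lexx.
have md2 : Num.min d1 d2 <= d2 by rewrite ge_min lexx orbT.
have m0 : 0 < Num.min d1 d2 by rewrite lt_min d10.
have s0 : 0 < s by rewrite divr_gt0.
have ss : `|s| + `|s| < Num.min d1 d2 by exact: double_quarter_lt.
have [y [yx Ey]] := second_difference j i s.
have [z [zx Ez]] := second_difference i j s.
have {}Ey : 'd_i ('d_j f) y = 'd_j ('d_i f) z.
  apply: (@mulfI _ s); first by rewrite gt_eqF.
  apply: (@mulfI _ s); first by rewrite gt_eqF.
  by rewrite -Ey -Ez addrCA subrBC.
have yr := d1P y (fun m => le_lt_trans (yx m) (lt_le_trans ss md1)).
have zr := d2P z (fun m => le_lt_trans (zx m) (lt_le_trans ss md2)).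
by move: yr zr; rewrite -Ey; exact: half_dist_contra.
Qed.

End row_vectors.

(** * The ring of smooth functions *)

(** The Euler field [x . grad], that is, [r d/dr]. *)
HB.lock Definition euler (K : realType) (n : nat) (f : 'rV[K]_n -> K) (x : 'rV[K]_n) : K :=
  \sum_i x ord0 i * 'd_i f x.

Lemma eulerE (K : realType) (n : nat) (f : 'rV[K]_n -> K) x :
  euler f x = \sum_i x ord0 i * 'd_i f x.
Proof. by rewrite euler.unlock. Qed.

Section smooth_functions.
Context {K : realType} {n : nat}.
Implicit Types (f g : 'rV[K]_n -> K) (x : 'rV[K]_n) (i j : 'I_n).
Local Notation e_ i := (delta_mx ord0 i : 'rV[K]_n).

Lemma smooth_continuous f : smooth f -> continuous f.
Proof. by move=> /(_ [::])[]. Qed.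

Lemma smooth_derivable f : smooth f -> forall i x, derivable f x (e_ i).
Proof. by move=> /(_ [::])[]. Qed.

Lemma smooth_pd f i : smooth f -> smooth ('d_i f).
Proof.
move=> sf s; have -> : partials s ('d_i f) = partials (rcons s i) f.
  by rewrite /partials foldr_rcons pdE.
exact: sf.
Qed.

Lemma smooth_is_derive f i x : smooth f -> is_derive x (e_ i) f ('d_i f x).
Proof. by rewrite pdE; move=> /smooth_derivable/(_ i x) /derivableP. Qed.

Lemma pd_val f i x (d : K) : is_derive x (e_ i) f d -> 'd_i f x = d.
Proof. by rewrite pdE; case. Qed.

(** A class of functions that is stable under partial derivatives and made of
    continuous, partially derivable functions consists of smooth functions. *)
Lemma smooth_coinduction (C : ('rV[K]_n -> K) -> Prop) :
  (forall f, C f -> [/\ continuous f, forall i x, derivable f x (e_ i) &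
     forall i, C ('d_i f)]) ->
  forall f, C f -> smooth f.
Proof.
move=> HC f Cf s; suff /HC[] : C (partials s f) by [].
elim: s => [//|i s /HC[_ _]/(_ i)]; by rewrite pdE.
Qed.

Lemma pd_cst (c : K) i x : 'd_i (fun=> c) x = 0.
Proof. by apply: pd_val; exact: is_derive_cst. Qed.

Lemma is_derive_coord i j x :
  is_derive x (e_ i) (fun y => y ord0 j) ((i == j)%:R).
Proof.
have dc := @differentiable_coord K 1 n x ord0 j.
split; first exact: diff_derivable.
rewrite /derive; apply: cvg_lim => //.
apply: cvg_near_cst; exists 1 => //= h _ h0.
rewrite !mxE eqxx/= addrK eq_sym -[LHS]/(h^-1 * (h * (i == j)%:R)).
by rewrite mulKf.
Qed.

Lemma pd_coord i j x : 'd_i (fun y => y ord0 j) x = (i == j)%:R.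
Proof. by apply: pd_val; exact: is_derive_coord. Qed.

Lemma smooth_cst (c : K) : smooth (fun _ : 'rV[K]_n => c).
Proof.
apply: (smooth_coinduction (C := fun f => exists c, f = fun=> c)); last by exists c.
move=> _ [{}c ->]; split; [exact: cst_continuous|by move=> *; exact: derivable_cst|].
by move=> i; exists 0; apply/funext => x; exact: pd_cst.
Qed.

Lemma smooth_coord j : smooth (fun x : 'rV[K]_n => x ord0 j).
Proof.
apply: (smooth_coinduction
  (C := fun f => smooth f \/ f = fun x => x ord0 j)); last by right.
move=> g [sg|->].
  split; [exact: smooth_continuous|exact: smooth_derivable|].
  by move=> i; left; exact: smooth_pd.
split; first exact: continuous_coord.
  by move=> i x; exact: (@ex_derive _ _ _ _ _ _ _ (is_derive_coord i j x)).
move=> i; left; rewrite (_ : 'd_i _ = fun=> (i == j)%:R); first exact: smooth_cst.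
by apply/funext => x; exact: pd_coord.
Qed.

(** The ring generated by the smooth functions and a further set [B].  By the
    Leibniz rule it is stable under partial derivatives as soon as it contains
    those of the members of [B]; this is how smoothness is proved below. *)
Inductive ring_generated (B : ('rV[K]_n -> K) -> Prop) : ('rV[K]_n -> K) -> Prop :=
| gen_smooth f : smooth f -> ring_generated B f
| gen_base f : B f -> ring_generated B f
| gen_add f g : ring_generated B f -> ring_generated B g ->
    ring_generated B (fun x => f x + g x)
| gen_mul f g : ring_generated B f -> ring_generated B g ->
    ring_generated B (fun x => f x * g x).

Lemma smooth_generated (B : ('rV[K]_n -> K) -> Prop) :
  (forall f, B f -> [/\ continuous f, forall i x, derivable f x (e_ i) &
     forall i, ring_generated B ('d_i f)]) ->
  forall f, ring_generated B f -> smooth f.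
Proof.
move=> HB; apply: smooth_coinduction => f; elim=> {f}.
- move=> f sf; split; [exact: smooth_continuous|exact: smooth_derivable|].
  by move=> i; apply: gen_smooth; exact: smooth_pd.
- by move=> f /HB.
- move=> f g Bf [cf df pf] Bg [cg dg pg]; split.
  + by move=> x; apply: continuousD; [exact: cf|exact: cg].
  + by move=> i x; apply: derivableD; [exact: df|exact: dg].
  + move=> i; rewrite (_ : 'd_i _ = fun x => 'd_i f x + 'd_i g x).
      exact: gen_add.
    by rewrite !pdE; apply/funext => x; exact: deriveD.
- move=> f g Bf [cf df pf] Bg [cg dg pg]; split.
  + by move=> x; apply: continuousM; [exact: cf|exact: cg].
  + by move=> i x; apply: derivableM; [exact: df|exact: dg].
  + move=> i; rewrite (_ : 'd_i _ = fun x => f x * 'd_i g x + g x * 'd_i f x).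
      by apply: gen_add; exact: gen_mul.
    by rewrite !pdE; apply/funext => x; exact: deriveM.
Qed.

Let smooth_gen f : ring_generated (fun=> False) f -> smooth f.
Proof. exact: smooth_generated. Qed.

Lemma smoothD f g : smooth f -> smooth g -> smooth (fun x => f x + g x).
Proof. by move=> sf sg; apply/smooth_gen/gen_add; exact: gen_smooth. Qed.

Lemma smoothM f g : smooth f -> smooth g -> smooth (fun x => f x * g x).
Proof. by move=> sf sg; apply/smooth_gen/gen_mul; exact: gen_smooth. Qed.

Lemma smoothZ (c : K) f : smooth f -> smooth (fun x => c * f x).
Proof. exact/smoothM/smooth_cst. Qed.

Lemma smooth_sum (I : eqType) (r : seq I) (F : I -> 'rV[K]_n -> K) :
  (forall k, smooth (F k)) -> smooth (fun x => \sum_(k <- r) F k x).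
Proof.
move=> sF; elim: r => [|k r IH].
  by under eq_fun do rewrite big_nil; exact: smooth_cst.
by under eq_fun do rewrite big_cons; exact: smoothD.
Qed.

Lemma pdD f g i x : smooth f -> smooth g ->
  'd_i (fun y => f y + g y) x = 'd_i f x + 'd_i g x.
Proof. by move=> sf sg; rewrite !pdE; apply: deriveD; exact: smooth_derivable. Qed.

Lemma pdM f g i x : smooth f -> smooth g ->
  'd_i (fun y => f y * g y) x = f x * 'd_i g x + g x * 'd_i f x.
Proof. by move=> sf sg; rewrite !pdE; apply: deriveM; exact: smooth_derivable. Qed.

Lemma pdZ (c : K) f i x : smooth f -> 'd_i (fun y => c * f y) x = c * 'd_i f x.
Proof.
by move=> sf; rewrite (pdM _ _ (smooth_cst c))// pd_cst mulr0 addr0.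
Qed.

Lemma pd_sum (I : eqType) (r : seq I) (F : I -> 'rV[K]_n -> K) i x :
  (forall k, smooth (F k)) ->
  'd_i (fun y => \sum_(k <- r) F k y) x = \sum_(k <- r) 'd_i (F k) x.
Proof.
move=> sF; elim: r => [|k r IH].
  by under eq_fun do rewrite big_nil; rewrite big_nil pd_cst.
under eq_fun do rewrite big_cons.
by rewrite pdD//; [rewrite IH big_cons|exact: smooth_sum].
Qed.

Lemma pd_comm f i j x : smooth f -> 'd_i ('d_j f) x = 'd_j ('d_i f) x.
Proof.
move=> sf; apply: derive_comm => [k y|k l y|k l].
- exact: smooth_derivable.
- by apply: smooth_derivable; exact: smooth_pd.
- by apply: smooth_continuous; do 2!apply: smooth_pd.
Qed.

Lemma smooth_directional f x v : smooth f ->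
  differentiable f x /\ 'D_v f x = \sum_i v ord0 i * 'd_i f x.
Proof.
move=> sf; have [] := @C1_differentiable _ _ f x.
- exact: smooth_derivable.
- by move=> i; apply: smooth_continuous; exact: smooth_pd.
- by move=> df dE; split.
Qed.

Lemma smooth_euler f : smooth f -> smooth (euler f).
Proof.
move=> sf; rewrite (funext (eulerE f)); apply: smooth_sum => i.
by apply: smoothM; [exact: smooth_coord|exact: smooth_pd].
Qed.

Definition sqn x : K := \sum_i x ord0 i ^+ 2.

Lemma sqn_ge0 x : 0 <= sqn x.
Proof. by apply: sumr_ge0 => i _; exact: sqr_ge0. Qed.

Lemma smooth_sqn : smooth sqn.
Proof. by apply: smooth_sum => i; apply: smoothM; exact: smooth_coord. Qed.

Lemma pd_sqn i x : 'd_i sqn x = 2 * x ord0 i.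
Proof.
rewrite pd_sum; last by move=> j; apply: smoothM; exact: smooth_coord.
rewrite (bigD1 i)//= big1 ?addr0 => [|j ji]; rewrite pdM ?pd_coord//; try exact: smooth_coord.
  by rewrite eqxx mulr1 mulr_natl.
by rewrite eq_sym (negbTE ji) mulr0 addr0.
Qed.

Lemma enorm_sqr x : enorm x ^+ 2 = sqn x.
Proof. by rewrite sqr_sqrtr// sqn_ge0. Qed.

Lemma enorm_ge0 x : 0 <= enorm x.
Proof. exact: sqrtr_ge0. Qed.

Lemma continuous_enorm : continuous (@enorm K n).
Proof.
move=> x; apply: (@continuous_comp _ _ _ sqn (@Num.sqrt K)).
  exact: smooth_continuous smooth_sqn x.
exact: sqrt_continuous.
Qed.

End smooth_functions.

(** * Smooth functions supported in an annulus *)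

Lemma continuous_near0 (K : realType) (T : topologicalType) (f : T -> K) x :
  (\forall y \near x, 0 = f y) -> {for x, continuous f}.
Proof.
move=> f0; have fx0 : f x = 0 by rewrite -(nbhs_singleton f0).
rewrite /prop_for /continuous_at fx0; apply: cvg_near_cst.
by apply: filterS f0 => y <-.
Qed.

Section annular_functions.
Context {K : realType} {n : nat} (a b : K).
Hypothesis a_gt0 : 0 < a.
Implicit Types (f g : 'rV[K]_n -> K) (x : 'rV[K]_n) (i j : 'I_n).
Local Notation e_ i := (delta_mx ord0 i : 'rV[K]_n).

(** The test functions of a punctured ball are the smooth functions supported
    in some closed annulus inside it.  With the radii fixed, the class is a
    vector space stable under all the operators used below. *)
Record annular f : Prop := Annular {
  annular_smooth : smooth f;
  annular_support : forall x, f x != 0 -> a <= enorm x <= b }.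

Lemma near_notin_annulus x : ~~ (a <= enorm x <= b) ->
  \forall y \near x, ~~ (a <= enorm y <= b).
Proof.
rewrite negb_and -!ltNge => /orP[xa|bx].
  have near_a : \forall y \near x, enorm y < a.
    exact: (@continuous_enorm K n x _ (lt_nbhsl xa)).
  by apply: filterS near_a => y ya; rewrite negb_and -!ltNge ya.
have near_b : \forall y \near x, b < enorm y.
  exact: (@continuous_enorm K n x _ (lt_nbhsr bx)).
by apply: filterS near_b => y yb; rewrite negb_and -!ltNge yb orbT.
Qed.

Lemma annular_eq0 f x : annular f -> ~~ (a <= enorm x <= b) -> f x = 0.
Proof. by move=> [_ sf]; apply: contraNeq; exact: sf. Qed.

Lemma vanish_near0 f x : (forall y, f y != 0 -> a <= enorm y <= b) ->
  ~~ (a <= enorm x <= b) -> \forall y \near x, 0 = f y.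
Proof.
move=> sf /near_notin_annulus; apply: filterS => y ya.
by apply/esym/eqP; apply: contraNT ya; exact: sf.
Qed.

Lemma is_derive_near0 f x i : (\forall y \near x, 0 = f y) ->
  is_derive x (e_ i) f 0.
Proof. by move=> /near_eq_is_derive; apply; exact: is_derive_cst. Qed.

Lemma annulus_sqn_neq0 x : (a <= enorm x <= b) -> sqn x != 0.
Proof.
by move=> /andP[ax _]; rewrite -enorm_sqr expf_neq0// gt_eqF// (lt_le_trans a_gt0).
Qed.

Lemma annularM f g : smooth f -> annular g -> annular (fun x => f x * g x).
Proof.
move=> sf [sg ag]; split; first exact: smoothM.
by move=> x; rewrite mulf_eq0 negb_or => /andP[_ /ag].
Qed.

Lemma annularD f g : annular f -> annular g -> annular (fun x => f x + g x).
Proof.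
move=> [sf af] [sg ag]; split; first exact: smoothD.
move=> x fg; have [fx0|/af//] := eqVneq (f x) 0.
by apply: ag; rewrite fx0 add0r in fg.
Qed.

Lemma annularZ c f : annular f -> annular (fun x => c * f x).
Proof. by apply: annularM; exact: smooth_cst. Qed.

Lemma annularN f : annular f -> annular (fun x => - f x).
Proof. by move=> /(annularZ (-1)); under eq_fun do rewrite mulN1r. Qed.

Lemma annularB f g : annular f -> annular g -> annular (fun x => f x - g x).
Proof. by move=> af /annularN; exact: annularD. Qed.

Lemma annular0 : annular (fun=> 0).
Proof. by split=> [|x]; [exact: smooth_cst|rewrite eqxx]. Qed.

Lemma annular_sum (I : eqType) (r : seq I) (F : I -> 'rV[K]_n -> K) :
  (forall k, annular (F k)) -> annular (fun x => \sum_(k <- r) F k x).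
Proof.
move=> aF; elim: r => [|k r IH].
  by under eq_fun do rewrite big_nil; exact: annular0.
by under eq_fun do rewrite big_cons; exact: annularD.
Qed.

Lemma annular_pd f i : annular f -> annular ('d_i f).
Proof.
move=> [sf af]; split; first exact: smooth_pd.
move=> x; apply: contraNT => /(vanish_near0 af)/(is_derive_near0 i)/pd_val ->.
by rewrite eqxx.
Qed.

Lemma annular_euler f : annular f -> annular (euler f).
Proof.
move=> af; rewrite (funext (eulerE f)).
apply: annular_sum => i; apply: annularM; first exact: smooth_coord.
exact: annular_pd.
Qed.

(** Multiplication by [|x|^-2].  The weight is singular only at the origin, where
    annular functions vanish in a neighbourhood. *)
Definition div_sqn f x := (sqn x)^-1 * f x.

Lemma is_derive_div_sqn_pow f x i k : annular f ->
  is_derive x (e_ i) (fun y => (sqn y)^-1 ^+ k * f y)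
    ((sqn x)^-1 ^+ k.+1 * (- (2 * k%:R) * x ord0 i * f x)
     + (sqn x)^-1 ^+ k * 'd_i f x).
Proof.
move=> af; have [xab|xab] := boolP (a <= enorm x <= b); last first.
  rewrite (annular_eq0 af xab) (annular_eq0 (annular_pd i af) xab) !mulr0 addr0.
  apply: is_derive_near0; have [_ fab] := af.
  apply: filterS (vanish_near0 fab xab) => y <-; exact/esym/mulr0.
have x0 := annulus_sqn_neq0 xab.
have dq := smooth_is_derive i x (@smooth_sqn K n).
have dqV : is_derive x (e_ i) (fun y => (sqn y)^-1) (- (sqn x) ^- 2 *: 'd_i sqn x).
  split; first exact: (derivableV x0 (@ex_derive _ _ _ _ _ _ _ dq)).
  by rewrite deriveV// ?pdEx//; exact: (@ex_derive _ _ _ _ _ _ _ dq).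
have df := smooth_is_derive i x (annular_smooth af).
rewrite (_ : (fun y => _) = (fun y => (sqn y)^-1) ^+ k * f); last first.
  by apply/funext => y; rewrite -[RHS]/((_ ^+ _) y * _ y) exprfctE.
apply: (is_derive_eq (is_deriveM (is_deriveX k dqV) df)).
rewrite exprfctE pd_sqn; change ((sqn x)^-1 ^+ k * 'd_i f x
  + f x * (k%:R * (sqn x)^-1 ^+ k.-1 * (- (sqn x) ^- 2 * (2 * x ord0 i))) =
  (sqn x)^-1 ^+ k.+1 * (- (2 * k%:R) * x ord0 i * f x)
  + (sqn x)^-1 ^+ k * 'd_i f x).
case: k => [|k]; first by rewrite mul0r mul0r !mulr0 oppr0 !mul0r mulr0 addrC.
by rewrite -exprVn [k.+1.-1]/= [_ ^+ k.+2]exprS [_ ^+ k.+1]exprS; ring.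
Qed.

(** Differentiating [|x|^-2k f] produces [|x|^-2(k+1)], so the generating set has
    to contain all these powers at once. *)
Lemma annular_div_sqn f : annular f -> annular (div_sqn f).
Proof.
move=> af; split; last first.
  by move=> x; rewrite mulf_eq0 negb_or => /andP[_]; exact: (annular_support af).
pose B g := exists k h, annular h /\ g = fun y => (sqn y)^-1 ^+ k * h y.
apply: (@smooth_generated _ _ B); last first.
  by apply: gen_base; exists 1%N, f; split.
move=> _ [k [h [ah ->]]]; split.
- move=> x; have [xab|xab] := boolP (a <= enorm x <= b); last first.
    apply: continuous_near0; have [_ hab] := ah.
    by apply: filterS (vanish_near0 hab xab) => y <-; exact/esym/mulr0.
  apply: (@continuousM _ _ (fun y => (sqn y)^-1 ^+ k) h x); last first.
    exact: smooth_continuous (annular_smooth ah) x.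
  apply: (@continuous_comp _ _ _ (fun y => (sqn y)^-1) (fun t : K => t ^+ k)).
    apply: continuousV; first exact: annulus_sqn_neq0 xab.
    exact: smooth_continuous (@smooth_sqn K n) x.
  exact: exprn_continuous.
- by move=> i x; exact: (@ex_derive _ _ _ _ _ _ _ (is_derive_div_sqn_pow x i k ah)).
- move=> i.
  have -> : 'd_i (fun y => (sqn y)^-1 ^+ k * h y) = fun x =>
      (sqn x)^-1 ^+ k.+1 * (- (2 * k%:R) * x ord0 i * h x)
      + (sqn x)^-1 ^+ k * 'd_i h x.
    by apply/funext => x; apply: pd_val; exact: is_derive_div_sqn_pow.
  apply: gen_add; apply: gen_base.
    exists k.+1, (fun x => - (2 * k%:R) * x ord0 i * h x); split => //.
    apply: annularM => //; apply: smoothM; first exact: smooth_cst.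
    exact: smooth_coord.
  by exists k, ('d_i h); split => //; exact: annular_pd.
Qed.

Lemma pd_div_sqn f i x : annular f ->
  'd_i (div_sqn f) x = div_sqn ('d_i f) x - 2 * x ord0 i * div_sqn (div_sqn f) x.
Proof.
move=> af; apply: (pd_val (d := _)).
apply: is_derive_eq (is_derive_div_sqn_pow x i 1 af) _.
by rewrite /div_sqn; ring.
Qed.

Lemma sqn_div_sqn f x : annular f -> sqn x * div_sqn f x = f x.
Proof.
move=> af; have [xab|xab] := boolP (a <= enorm x <= b).
  by rewrite mulrA mulfV ?mul1r// (annulus_sqn_neq0 xab).
by rewrite /div_sqn (annular_eq0 af xab) !mulr0.
Qed.

End annular_functions.

(** * The integral of a partial derivative *)

Section integration.
Context {K : realType} {n : nat}.
Implicit Types (f g : 'rV[K]_n -> K) (x : 'rV[K]_n) (i j : 'I_n) (b : K).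
Local Notation mu := (@lebesgue_rV K n).
Local Notation e_ i := (delta_mx ord0 i : 'rV[K]_n).
Local Notation integrableT f := (mu.-integrable [set: 'rV[K]_n] (EFin \o f)).

Definition box b : set 'rV[K]_n := [set x | forall i, `|x ord0 i| <= b].

Lemma coord_le_enorm x i : `|x ord0 i| <= enorm x.
Proof.
rewrite -sqrtr_sqr ler_sqrt ?sumr_ge0// => [|j _]; last exact: sqr_ge0.
by rewrite (bigD1 i)//= lerDl sumr_ge0// => j _; exact: sqr_ge0.
Qed.

Lemma enorm_eq0 x : enorm x = 0 -> x = 0.
Proof.
move=> x0; apply/rowP => i; apply/eqP; rewrite mxE -normr_le0 -x0.
exact: coord_le_enorm.
Qed.

Let boxE b : box b = [set x | forall i, x ord0 i \in `[- b, b]%R].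
Proof.
by apply/seteqP; split=> x xb i; have := xb i; rewrite in_itv/= ler_norml.
Qed.

Lemma measurable_box b : measurable (box b).
Proof.
rewrite (_ : box b = \bigcap_(i in [set: 'I_n])
    ((fun x => x ord0 i) @^-1` `[- b, b]%classic)).
  apply: fin_bigcap_measurable => // i _.
  by rewrite -[X in measurable X]setTI; apply: measurable_rV_coord.
by rewrite boxE; apply/seteqP; split=> x /= xb i; [move=> _|]; exact: xb.
Qed.

Lemma box_finite b : (mu (box b) < +oo)%E.
Proof.
rewrite boxE (lebesgue_rV_box (A := fun=> `[- b, b]%classic))//.
rewrite ltey_eq; apply/orP; left.
elim/big_ind : _ => [//|x y xfin yfin|i _]; first by rewrite fin_numM.
by rewrite /= lebesgue_measure_itv/=; case: ifP.
Qed.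

Lemma compact_box b : compact (box b).
Proof.
rewrite boxE; apply: (@rV_compact _ _ (fun=> `[- b, b]%classic)) => _.
exact: segment_compact.
Qed.

Lemma integral_box b (f : 'rV[K]_n -> \bar K) : (forall x, f x != 0%E -> box b x) ->
  (\int[mu]_x f x = \int[mu]_(x in box b) f x)%E.
Proof.
move=> fb; rewrite [RHS]integral_mkcond; congr (integral _ _ _).
apply/funext => x; rewrite patchE; case: ifPn => // /negP xb.
by apply/eqP; apply: contra_notT xb => /fb; rewrite inE.
Qed.

Lemma integrable_bounded_box b M f : measurable_fun setT (f : _ -> measurableTypeR K) ->
  (forall x, `|f x| <= M) -> (forall x, f x != 0 -> box b x) -> integrableT f.
Proof.
move=> mf fM fb.
have : mu.-integrable (box b) (EFin \o f).
  apply: measurable_bounded_integrable.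
  - exact: measurable_box.
  - exact: box_finite.
  - exact: measurable_funTS.
  - exists M; split; first exact: num_real.
    by move=> y My x _; exact: le_trans (fM x) (ltW My).
move=> /(integrable_mkcond _ (measurable_box b)).
apply: eq_integrable => // x _; rewrite patchE /=; case: ifPn => // /negP xb.
by congr EFin; apply/esym/eqP; apply: contra_notT xb => /fb; rewrite inE.
Qed.

Lemma continuous_box_bounded b f : continuous f -> (forall x, f x != 0 -> box b x) ->
  exists2 M, 0 <= M & forall x, `|f x| <= M.
Proof.
move=> cf fb.
have [M [_ HM]] : bounded_set (f @` box b).
  apply: compact_bounded; apply: continuous_compact; last exact: compact_box.
  exact: continuous_subspaceT.
exists (`|M| + 1) => [|x]; first by rewrite addr_ge0.
have [->|/fb xb] := eqVneq (f x) 0; first by rewrite normr0 addr_ge0.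
by apply: HM; [rewrite (le_lt_trans (ler_norm _))// ltrDl|exists x].
Qed.

Lemma integrable_continuous_box b f : continuous f ->
  (forall x, f x != 0 -> box b x) -> integrableT f.
Proof.
move=> cf fb; have [M _ fM] := continuous_box_bounded cf fb.
by apply: integrable_bounded_box fM fb; exact: continuous_measurable_rV.
Qed.

Lemma integral_translate f (c : 'rV[K]_n) : measurable_fun setT (f : _ -> measurableTypeR K) ->
  (\int[mu]_x (f (x + c)%R)%:E = \int[mu]_x (f x)%:E)%E.
Proof.
move=> mf.
have ge0 (g : 'rV[K]_n -> \bar K) : measurable_fun setT g -> (forall x, 0 <= g x)%E ->
    (\int[mu]_x g (x + c)%R = \int[mu]_x g x)%E.
  move=> mg g0; have := ge0_integral_affine c (@ltr01 K) mg g0.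
  by rewrite expr1n invr1 mul1e => <-; under [RHS]eq_integral do rewrite scale1r.
have mfE : measurable_fun setT (EFin \o f) by exact/measurable_EFinP.
rewrite [LHS](integralE _ _ ((EFin \o f) \o (fun x => x + c))) [RHS]integralE.
rewrite funepos_comp funeneg_comp.
have pos := ge0 _ (measurable_funepos mfE) (fun x => funepos_ge0 (EFin \o f) x).
have neg := ge0 _ (measurable_funeneg mfE) (fun x => funeneg_ge0 (EFin \o f) x).
by congr (_ - _)%E; [exact: pos|exact: neg].
Qed.

Lemma difference_quotient f i (k : nat) x : (forall y, derivable f y (e_ i)) ->
  exists2 c, `|c| <= k.+1%:R^-1 &
    k.+1%:R * (f (x + k.+1%:R^-1 *: e_ i) - f x) = 'd_i f (c *: e_ i + x).
Proof.
move=> df; have [c ck E] := MVT_line x k.+1%:R^-1 df.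
exists c; first by rewrite (le_trans ck)// ger0_norm.
by rewrite (addrC x) E pdEx mulrA mulfV// mul1r.
Qed.

(** By translation invariance the difference quotients of [f] have integral
    zero; they are bounded by the supremum of the partial derivative, live on a
    common box, and converge to the partial derivative, so that dominated
    convergence applies. *)
Lemma integral_pd_eq0 b f i : continuous f -> (forall y, derivable f y (e_ i)) ->
  continuous ('d_i f) -> (forall x, f x != 0 -> box b x) ->
  (forall x, 'd_i f x != 0 -> box b x) ->
  (\int[mu]_x ('d_i f x)%:E = 0)%E.
Proof.
move=> cf df cdf fb dfb.
have [M M0 dfM] := continuous_box_bounded cdf dfb.
have mf := continuous_measurable_rV cf.
have mdf := continuous_measurable_rV cdf.
pose tau k (x : 'rV[K]_n) := x + k.+1%:R^-1 *: e_ i.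
pose u k x := k.+1%:R * (f (tau k x) - f x).
have mtau k : measurable_fun setT (tau k : 'rV[K]_n -> 'rV[K]_n).
  rewrite (_ : tau k = fun x => 1 *: x + k.+1%:R^-1 *: e_ i); last first.
    by apply/funext => x; rewrite scale1r.
  exact: measurable_affine_rV.
have mftau k : measurable_fun setT (f \o tau k : _ -> measurableTypeR K).
  exact: measurableT_comp mf (mtau k).
have mu_ k : measurable_fun setT (u k : _ -> measurableTypeR K).
  apply: measurable_funM; first exact: measurable_cst.
  exact: measurable_funB (mftau k) mf.
have uE k x : exists2 c, `|c| <= k.+1%:R^-1 & u k x = 'd_i f (c *: e_ i + x).
  exact: difference_quotient.
have k1 (k : nat) : k.+1%:R^-1 <= 1 :> K by rewrite invf_le1// ler1n.
have near_box k x c : `|c| <= k.+1%:R^-1 -> box b (c *: e_ i + x) -> box (b + 1) x.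
  move=> ck xb j; have := xb j; rewrite !mxE eqxx/= => xj.
  rewrite -[x _ _](addKr (c * (j == i)%:R)) (le_trans (ler_normD _ _))//.
  rewrite addrC normrN lerD// normrM; apply: le_trans (le_trans ck (k1 k)).
  by rewrite ler_piMr//; case: (j == i); rewrite ?normr1 ?normr0.
have fb1 x : f x != 0 -> box (b + 1) x.
  by move=> /fb xb j; rewrite (le_trans (xb j))// lerDl.
have dfb1 x : 'd_i f x != 0 -> box (b + 1) x.
  by move=> /dfb xb j; rewrite (le_trans (xb j))// lerDl.
have tau_box k x : f (tau k x) != 0 -> box (b + 1) x.
  rewrite /tau addrC => /fb; apply: (near_box k).
  by rewrite ger0_norm.
have itau k : integrableT (f \o tau k).
  have [Mf _ fM] := continuous_box_bounded cf fb.
  by apply: (@integrable_bounded_box (b + 1) Mf) => // x; [exact: fM|exact: tau_box].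
have int_f : integrableT f by exact: integrable_continuous_box fb.
have int_u k : (\int[mu]_x (u k x)%:E = 0)%E.
  rewrite /u; under eq_integral do rewrite EFinM.
  rewrite integralZl//; last first.
    by apply: eq_integrable (integrableB _ (itau k) int_f).
  under eq_integral do rewrite EFinB.
  rewrite integralB_EFin//; last exact: (itau k).
  transitivity (k.+1%:R%:E * (\int[mu]_x (f x)%:E - \int[mu]_x (f x)%:E))%E.
    by congr (_ * (_ - _))%E; exact: integral_translate.
  by rewrite subee ?mule0// integrable_fin_num.
(* Steps are at most 1, so all difference quotients vanish off this box. *)
pose B := box (b + 1).
have mB : measurable B by exact: measurable_box.
have u_B k x : u k x != 0 -> B x.
  by have [c ck ->] := uE k x => /dfb; exact: near_box ck.
have [_ _ lim_u] : [/\ mu.-integrable B (EFin \o 'd_i f),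
    [sequence (\int[mu]_(x in B) `|(u k x)%:E - ('d_i f x)%:E|)%E]_k @ \oo --> 0%E &
    [sequence (\int[mu]_(x in B) (u k x)%:E)%E]_k @ \oo --> (\int[mu]_(x in B) ('d_i f x)%:E)%E].
  apply: (@dominated_convergence _ _ _ mu B mB (fun k x => (u k x)%:E)
    (fun x => ('d_i f x)%:E) (cst M%:E)).
  - by move=> k; apply/measurable_EFinP; exact: measurable_funTS (mu_ k).
  - by apply/measurable_EFinP; exact: measurable_funTS mdf.
  - apply: aeW => x _; apply: cvg_EFin; first exact: nearW.
    apply/cvgrPdist_lt => e e0.
    have [d d0 dP] := row_near (cdf x _ (nbhsx_ballx _ _ e0)).
    have : \forall k \near \oo, k.+1%:R^-1 < d.
      exact: (near_infty_natSinv_lt (PosNum d0)).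
    apply: filterS => k kd /=; have [c ck ->] := uE k x.
    apply: dP => j; rewrite !mxE eqxx/= addrK normrM (le_lt_trans _ kd)//.
    apply: le_trans ck; rewrite ler_piMr//.
    by case: (j == i); rewrite ?normr1 ?normr0.
  - apply: measurable_bounded_integrable => //; first exact: box_finite.
    exact: bounded_cst.
  - by apply: aeW => x k _; rewrite /= lee_fin; have [c _ ->] := uE k x.
rewrite (integral_box (b := b + 1)); last first.
  by move=> x; rewrite eqe; exact: dfb1.
apply: (cvg_unique _ lim_u); first exact: ereal_hausdorff.
rewrite (_ : [sequence _]_k = cst 0%E); first exact: cvg_cst.
apply/funext => k /=; rewrite -[RHS](int_u k) [RHS](integral_box (b := b + 1))//.
by move=> x; rewrite eqe; exact: u_B.
Qed.

End integration.

(** * The Euler field and a weighted scalar product *)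

HB.lock Definition total (K : realType) (n : nat) (f : 'rV[K]_n -> K) : K :=
  fine (\int[lebesgue_rV n]_x (f x)%:E)%E.

(** The scalar product with weight [|x|^-4]; the integral of [(lap f)^2] is the
    square of [|x|^2 lap f] for it. *)
HB.lock Definition ip (K : realType) (n : nat) (f g : 'rV[K]_n -> K) : K :=
  total (fun x => div_sqn f x * div_sqn g x).

Lemma ipE (K : realType) (n : nat) (f g : 'rV[K]_n -> K) :
  ip f g = total (fun x => div_sqn f x * div_sqn g x).
Proof. by rewrite ip.unlock. Qed.

Section weighted_form.
Context {K : realType} {n : nat} (a b : K).
Hypothesis a_gt0 : 0 < a.
Implicit Types (f g h : 'rV[K]_n -> K) (x : 'rV[K]_n) (i j : 'I_n).
Local Notation mu := (@lebesgue_rV K n).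
Local Notation integrableT f := (mu.-integrable [set: 'rV[K]_n] (EFin \o f)).
Local Notation annular := (annular a b).

Lemma annular_box f : annular f -> forall x, f x != 0 -> box b x.
Proof.
by move=> [_ fab] x /fab /andP[_ xb] i; exact: le_trans (coord_le_enorm x i) xb.
Qed.

Lemma annular_integrable f : annular f -> integrableT f.
Proof.
move=> af; apply: integrable_continuous_box (annular_box af).
exact: smooth_continuous (annular_smooth af).
Qed.

Lemma EFin_total f : annular f -> ((total f)%:E = \int[mu]_x (f x)%:E)%E.
Proof.
by move=> af; rewrite total.unlock fineK// integrable_fin_num//; exact: annular_integrable.
Qed.

Lemma total_lin c f g : annular f -> annular g ->
  total (fun x => f x + c * g x) = total f + c * total g.
Proof.
move=> af ag; apply: EFin_inj; rewrite EFinD EFinM !EFin_total//; last first.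
  by apply: annularD => //; exact: annularZ.
under eq_integral do rewrite EFinD EFinM.
rewrite integralD//; last 2 first.
- exact: annular_integrable.
- exact: (annular_integrable (annularZ c ag)).
by rewrite integralZl//; exact: annular_integrable.
Qed.

Lemma total0 : total (fun _ : 'rV[K]_n => 0) = 0.
Proof. by rewrite total.unlock integral0. Qed.

Lemma totalD f g : annular f -> annular g ->
  total (fun x => f x + g x) = total f + total g.
Proof.
move=> af ag; rewrite -[X in _ + X]mul1r -total_lin//; congr total.
by apply/funext => x; rewrite mul1r.
Qed.

Lemma totalZ c f : annular f -> total (fun x => c * f x) = c * total f.
Proof.
move=> af; rewrite -[RHS]add0r -[X in X + _]total0 -total_lin//; last exact: annular0.
by congr total; apply/funext => x; rewrite add0r.
Qed.

Lemma total_sum (I : eqType) (r : seq I) (F : I -> 'rV[K]_n -> K) :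
  (forall k, annular (F k)) ->
  total (fun x => \sum_(k <- r) F k x) = \sum_(k <- r) total (F k).
Proof.
move=> aF; elim: r => [|k r IH].
  by under eq_fun do rewrite big_nil; rewrite big_nil total0.
under eq_fun do rewrite big_cons.
by rewrite totalD//; [rewrite IH big_cons|exact: annular_sum].
Qed.

Lemma total_ge0 f : (forall x, 0 <= f x) -> 0 <= total f.
Proof. by move=> f0; rewrite total.unlock fine_ge0// integral_ge0// => x _; rewrite lee_fin. Qed.

Lemma total_pd f i : annular f -> total ('d_i f) = 0.
Proof.
move=> af; have sf := annular_smooth af; rewrite total.unlock (@integral_pd_eq0 _ _ b)//.
- exact: smooth_continuous.
- exact: smooth_derivable.
- exact: smooth_continuous (smooth_pd i sf).
- exact: annular_box.
- exact: annular_box (annular_pd i af).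
Qed.

Lemma total_by_parts f g i : annular f -> annular g ->
  total (fun x => f x * 'd_i g x) = - total (fun x => g x * 'd_i f x).
Proof.
move=> af ag; have [sf sg] := (annular_smooth af, annular_smooth ag).
apply/eqP; rewrite -addr_eq0 -totalD; last 2 first.
- by apply: annularM => //; exact: annular_pd.
- by apply: annularM => //; exact: annular_pd.
rewrite -[X in _ == X](@total_pd (fun x => f x * g x) i); last exact: annularM.
by apply/eqP; congr total; apply/funext => x; rewrite pdM.
Qed.

Lemma eulerM f g x : smooth f -> smooth g ->
  euler (fun y => f y * g y) x = f x * euler g x + g x * euler f x.
Proof.
move=> sf sg; rewrite !eulerE !mulr_sumr -big_split/=; apply: eq_bigr => i _.
by rewrite pdM//; ring.
Qed.

Lemma eulerD f g x : smooth f -> smooth g ->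
  euler (fun y => f y + g y) x = euler f x + euler g x.
Proof.
move=> sf sg; rewrite !eulerE -big_split/=; apply: eq_bigr => i _.
by rewrite pdD// mulrDr.
Qed.

Lemma eulerZ c f x : smooth f -> euler (fun y => c * f y) x = c * euler f x.
Proof.
move=> sf; rewrite !eulerE mulr_sumr; apply: eq_bigr => i _.
by rewrite pdZ// mulrCA.
Qed.

Lemma euler_sum (I : eqType) (r : seq I) (F : I -> 'rV[K]_n -> K) x :
  (forall k, smooth (F k)) ->
  euler (fun y => \sum_(k <- r) F k y) x = \sum_(k <- r) euler (F k) x.
Proof.
move=> sF; under [RHS]eq_bigr do rewrite eulerE.
rewrite eulerE exchange_big/=; apply: eq_bigr => i _.
by rewrite pd_sum// mulr_sumr.
Qed.

Lemma euler_div_sqn f x : annular f ->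
  euler (div_sqn f) x = div_sqn (euler f) x - 2 * div_sqn f x.
Proof.
move=> af; have awf := annular_div_sqn a_gt0 af.
rewrite -(sqn_div_sqn a_gt0 x awf) [sqn x]/sqn mulr_suml mulr_sumr.
rewrite [div_sqn (euler f) x]/div_sqn !eulerE mulr_sumr -sumrB.
apply: eq_bigr => i _; rewrite (pd_div_sqn a_gt0 _ _ af) [div_sqn ('d_i f) x]/div_sqn.
by ring.
Qed.

Lemma euler_sqn x : euler sqn x = 2 * sqn x.
Proof.
by rewrite !eulerE [X in _ = 2 * X]/sqn mulr_sumr; apply: eq_bigr => i _; rewrite pd_sqn; ring.
Qed.

(** [x . grad f + n f] is the divergence of the vector field [f x]. *)
Lemma total_euler f : annular f -> total (euler f) = - n%:R * total f.
Proof.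
move=> af; have sf := annular_smooth af.
have div_xf x : \sum_i 'd_i (fun y => y ord0 i * f y) x = euler f x + n%:R * f x.
  rewrite !eulerE mulr_natl -[n in _ *+ n](card_ord n) -sumr_const -big_split/=.
  apply: eq_bigr => i _; rewrite pdM//; last exact: smooth_coord.
  by rewrite pd_coord eqxx mulr1.
have axf i : annular (fun y => y ord0 i * f y).
  by apply: annularM => //; exact: smooth_coord.
apply/eqP; rewrite mulNr -addr_eq0 -total_lin//; last exact: annular_euler.
rewrite (_ : (fun x => _) = fun x => \sum_i 'd_i (fun y => y ord0 i * f y) x).
  rewrite total_sum => [|i]; last exact: annular_pd.
  by rewrite big1// => i _; rewrite total_pd.
by apply/funext => x; rewrite div_xf.
Qed.

Lemma ipC f g : ip f g = ip g f.
Proof. by rewrite !ipE; congr total; apply/funext => x; rewrite mulrC. Qed.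

Lemma ip_ge0 f : 0 <= ip f f.
Proof. by rewrite ipE; apply: total_ge0 => x; rewrite -expr2 sqr_ge0. Qed.

Lemma annular_div_sqnM f g : annular f -> annular g -> annular (fun x => div_sqn f x * div_sqn g x).
Proof.
move=> af ag; apply: annularM; last exact: annular_div_sqn.
exact: annular_smooth (annular_div_sqn a_gt0 af).
Qed.

Lemma ip_linl c f g h : annular f -> annular g -> annular h ->
  ip (fun x => f x + c * g x) h = ip f h + c * ip g h.
Proof.
move=> af ag ah; rewrite !ipE -total_lin; last 2 first.
- exact: annular_div_sqnM.
- exact: annular_div_sqnM.
by congr total; apply/funext => x; rewrite /div_sqn; ring.
Qed.

Lemma ip_linr c f g h : annular f -> annular g -> annular h ->
  ip h (fun x => f x + c * g x) = ip h f + c * ip h g.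
Proof. by move=> af ag ah; rewrite ipC ip_linl// ipC [ip g h]ipC. Qed.

Lemma ipZl c f h : annular f -> annular h -> ip (fun x => c * f x) h = c * ip f h.
Proof.
move=> af ah; rewrite !ipE -(totalZ _ (annular_div_sqnM af ah)); congr total.
by apply/funext => x; rewrite /div_sqn; ring.
Qed.

Lemma ipZr c f h : annular f -> annular h -> ip h (fun x => c * f x) = c * ip h f.
Proof. by move=> af ah; rewrite ipC ipZl// ipC. Qed.

(** The Euler field is antisymmetric up to a constant, because [|x|^-4 dx] is
    homogeneous of degree [n - 4]. *)
Lemma ip_euler f g : annular f -> annular g ->
  ip (euler f) g + ip f (euler g) = (4 - n%:R) * ip f g.
Proof.
move=> af ag; have awf := annular_div_sqn a_gt0 af; have awg := annular_div_sqn a_gt0 ag.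
have aE := annular_euler.
have := total_euler (annular_div_sqnM af ag).
rewrite (_ : euler _ = fun x => (div_sqn (euler f) x * div_sqn g x
    + 1 * (div_sqn f x * div_sqn (euler g) x)) + (- 4) * (div_sqn f x * div_sqn g x)); last first.
  apply/funext => x; rewrite eulerM ?euler_div_sqn//; last 2 first.
  - exact: annular_smooth awf.
  - exact: annular_smooth awg.
  by ring.
rewrite !total_lin -?ipE; last 4 first.
- by apply: annular_div_sqnM => //; exact: aE.
- by apply: annular_div_sqnM => //; exact: aE.
- apply: annularD; first by apply: annular_div_sqnM => //; exact: aE.
  by apply: annularZ; apply: annular_div_sqnM => //; exact: aE.
- exact: annular_div_sqnM.
by move=> E; lra.
Qed.

End weighted_form.

(** * The angular part of the Laplacian *)

HB.lock Definition lap (K : realType) (n : nat) (f : 'rV[K]_n -> K) (x : 'rV[K]_n) : K :=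
  \sum_i 'd_i ('d_i f) x.

Lemma lapE (K : realType) (n : nat) (f : 'rV[K]_n -> K) x :
  lap f x = \sum_i 'd_i ('d_i f) x.
Proof. by rewrite lap.unlock. Qed.

Lemma laplacianE (K : realType) (n : nat) (f : 'rV[K]_n -> K) :
  laplacian f = lap f.
Proof.
by apply/funext => x; rewrite lapE; apply: eq_bigr => i _; rewrite !pdE.
Qed.

(** [|x|^2] times the radial part [d^2/dr^2 + (n-1)/r d/dr] of the Laplacian. *)
HB.lock Definition radial_part (K : realType) (n : nat) (f : 'rV[K]_n -> K) (x : 'rV[K]_n) : K :=
  euler (euler f) x + (n%:R - 2) * euler f x.

Lemma radial_partE (K : realType) (n : nat) (f : 'rV[K]_n -> K) x :
  radial_part f x = euler (euler f) x + (n%:R - 2) * euler f x.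
Proof. by rewrite radial_part.unlock. Qed.

(** Minus the Laplacian of the unit sphere, acting on the angular variables. *)
HB.lock Definition angular_part (K : realType) (n : nat) (f : 'rV[K]_n -> K) (x : 'rV[K]_n) : K :=
  radial_part f x - sqn x * lap f x.

Lemma angular_partE (K : realType) (n : nat) (f : 'rV[K]_n -> K) x :
  angular_part f x = radial_part f x - sqn x * lap f x.
Proof. by rewrite angular_part.unlock. Qed.

(** The integral of [|x|^-4] times the scalar product of the gradients along the
    sphere, which is [|x|^2 grad f . grad g - (x . grad f) (x . grad g)]. *)
HB.lock Definition dirichlet (K : realType) (n : nat) (f g : 'rV[K]_n -> K) : K :=
  total (fun x => div_sqn (fun y => \sum_i 'd_i f y * 'd_i g y) x
    - div_sqn (euler f) x * div_sqn (euler g) x).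

Lemma dirichletE (K : realType) (n : nat) (f g : 'rV[K]_n -> K) :
  dirichlet f g = total (fun x => div_sqn (fun y => \sum_i 'd_i f y * 'd_i g y) x
    - div_sqn (euler f) x * div_sqn (euler g) x).
Proof. by rewrite dirichlet.unlock. Qed.

Section angular_laplacian.
Context {K : realType} {n : nat} (a b : K).
Hypothesis a_gt0 : 0 < a.
Implicit Types (f g h : 'rV[K]_n -> K) (x : 'rV[K]_n) (i j : 'I_n).
Local Notation annular := (annular a b).

Lemma smooth_lap f : smooth f -> smooth (lap f).
Proof.
move=> sf; rewrite (funext (lapE f)); apply: smooth_sum => i.
by do 2!apply: smooth_pd.
Qed.

Lemma annular_lap f : annular f -> annular (lap f).
Proof.
move=> af; rewrite (funext (lapE f)); apply: annular_sum => i.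
by do 2!apply: annular_pd.
Qed.

Lemma angular_part_sum f : angular_part f = fun x =>
  (euler (euler f) x + (n%:R - 2) * euler f x) + (-1) * (sqn x * lap f x).
Proof. by apply/funext => x; rewrite angular_partE radial_partE mulN1r. Qed.

Lemma annular_radial_part f : annular f -> annular (radial_part f).
Proof.
move=> af; have ae := annular_euler af.
rewrite (funext (radial_partE f)).
by apply: annularD; [exact: annular_euler|exact: annularZ].
Qed.

Lemma annular_angular_part f : annular f -> annular (angular_part f).
Proof.
move=> af; rewrite (funext (angular_partE f)).
apply: annularB; first exact: annular_radial_part.
by apply: annularM; [exact: smooth_sqn|exact: annular_lap].
Qed.

Lemma pd_euler f i x : smooth f ->
  'd_i (euler f) x = 'd_i f x + euler ('d_i f) x.
Proof.
move=> sf; rewrite eulerE (funext (eulerE f)) pd_sum => [|j]; last first.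
  by apply: smoothM; [exact: smooth_coord|exact: smooth_pd].
under eq_bigr => j _.
  rewrite pdM; [|exact: smooth_coord|exact: smooth_pd].
  rewrite pd_coord pd_comm//.
  over.
rewrite big_split/= addrC; congr (_ + _).
rewrite (bigD1 i)//= eqxx mulr1 big1 ?addr0// => j ji.
by rewrite eq_sym (negbTE ji) mulr0.
Qed.

Lemma lap_euler f x : smooth f ->
  lap (euler f) x = 2 * lap f x + euler (lap f) x.
Proof.
move=> sf; rewrite (funext (lapE f)) [X in _ = _ + X]euler_sum => [|i];
  last by do 2!apply: smooth_pd.
rewrite !lapE mulr_sumr -big_split/=; apply: eq_bigr => i _.
rewrite (_ : 'd_i (euler f) = fun x => 'd_i f x + euler ('d_i f) x).
  rewrite pdD; [|exact: smooth_pd|by apply: smooth_euler; exact: smooth_pd].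
  by rewrite pd_euler; [ring|exact: smooth_pd].
by apply/funext => y; exact: pd_euler.
Qed.

(** [|x|^2 lap] is homogeneous of degree zero, hence commutes with the Euler
    field. *)
Lemma angular_euler f x : smooth f ->
  euler (angular_part f) x = angular_part (euler f) x.
Proof.
move=> sf; have se := smooth_euler sf; have see := smooth_euler se.
have sl := smooth_lap sf.
have sc : smooth (fun x => (n%:R - 2) * euler f x) by exact: smoothZ.
have sr : smooth (fun x : 'rV[K]_n => sqn x * lap f x).
  exact: smoothM (@smooth_sqn K n) sl.
have srn : smooth (fun x : 'rV[K]_n => (-1) * (sqn x * lap f x)).
  exact: smoothZ.
rewrite (angular_part_sum f) angular_partE radial_partE.
rewrite (eulerD _ (smoothD see sc) srn) (eulerD _ see sc) (eulerZ _ _ se).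
rewrite (eulerZ _ _ sr) (eulerM _ (@smooth_sqn K n) sl).
rewrite euler_sqn (lap_euler _ sf).
move: (euler (euler _) x) (euler (euler f) x) (euler (lap f) x) (lap f x) (sqn x).
by move=> *; ring.
Qed.

Lemma dirichletC f g : dirichlet f g = dirichlet g f.
Proof.
rewrite !dirichletE; congr total; apply/funext => x; rewrite mulrC; congr (_ * _ - _).
by apply: eq_bigr => i _; rewrite mulrC.
Qed.

Lemma annular_grad f g : annular f -> annular g ->
  annular (fun x => \sum_i 'd_i f x * 'd_i g x).
Proof.
move=> af ag; apply: annular_sum => i; apply: annularM; last exact: annular_pd.
exact/smooth_pd/annular_smooth/af.
Qed.

Lemma ip_sqn_lap f g : annular f -> annular g ->
  ip f (fun x => sqn x * lap g x) =
  2 * ip f (euler g) - total (div_sqn (fun y => \sum_i 'd_i f y * 'd_i g y)).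
Proof.
move=> af ag; have awf := annular_div_sqn a_gt0 af.
have sg := annular_smooth ag; have al := annular_lap ag.
have adg i := annular_pd i ag.
rewrite !ipE (_ : (fun x => _) = fun x => \sum_i (div_sqn f x * 'd_i ('d_i g) x)); last first.
  apply/funext => x; rewrite -mulr_sumr -lapE.
  by rewrite -[in RHS](sqn_div_sqn a_gt0 x al) /div_sqn; ring.
have a1 i : annular (fun x => div_sqn f x * 'd_i ('d_i g) x).
  by apply: annularM; [exact: annular_smooth awf|exact: annular_pd].
have a2 i : annular (fun x => 'd_i g x * 'd_i (div_sqn f) x).
  by apply: annularM; [exact: annular_smooth (adg i)|exact: annular_pd].
rewrite (total_sum _ a1).
under eq_bigr => i _ do rewrite (total_by_parts _ awf (adg i)).
rewrite sumrN -(total_sum _ a2).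
have agr := annular_div_sqn a_gt0 (annular_grad af ag).
have age := annular_div_sqnM a_gt0 af (annular_euler ag).
rewrite -[RHS]opprB; congr (- _).
rewrite (_ : (fun x => _) = fun x => div_sqn (fun y => \sum_i 'd_i f y * 'd_i g y) x
     + (- 2) * (div_sqn f x * div_sqn (euler g) x)); last first.
  apply/funext => x; under eq_bigr => i _ do rewrite (pd_div_sqn a_gt0 _ _ af).
  rewrite /div_sqn !eulerE !mulr_sumr -big_split/=; apply: eq_bigr => i _.
  by move: ('d_i f x) ('d_i g x) (f x) (sqn x)^-1 (x ord0 i) => *; ring.
rewrite (total_lin _ agr age) -ipE.
by rewrite mulNr.
Qed.

(** Green's formula on spheres.  It makes the angular part symmetric and, by
    the Cauchy-Schwarz inequality [(x . grad f)^2 <= |x|^2 |grad f|^2], nonnegative. *)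
Lemma ip_angular f g : annular f -> annular g -> ip f (angular_part g) = dirichlet f g.
Proof.
move=> af ag; have ae := annular_euler.
have aeg := ae _ _ _ _ _ ag; have aeeg := ae _ _ _ _ _ aeg; have aef := ae _ _ _ _ _ af.
have al := annular_lap ag.
have asl : annular (fun x => sqn x * lap g x).
  by apply: annularM => //; exact: smooth_sqn.
have ace : annular (fun x => (n%:R - 2) * euler g x) by exact: annularZ.
rewrite (angular_part_sum g).
rewrite (ip_linr a_gt0 _ (annularD aeeg ace) asl af) (ip_linr a_gt0 _ aeeg aeg af).
rewrite (ip_sqn_lap af ag).
have := ip_euler a_gt0 af aeg.
have -> : dirichlet f g = total (div_sqn (fun y => \sum_i 'd_i f y * 'd_i g y))
    + (-1) * ip (euler f) (euler g).
  rewrite dirichletE !ipE -(total_lin _ (annular_div_sqn a_gt0 (annular_grad af ag))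
    (annular_div_sqnM a_gt0 aef aeg)).
  by congr total; apply/funext => x; rewrite mulN1r.
move: (ip _ (euler (euler _))) (ip _ (euler g)) (ip (euler f) _) (total _) => p q r t.
by move=> E; lra.
Qed.

Lemma dirichlet_ge0 f : annular f -> 0 <= dirichlet f f.
Proof.
move=> af; rewrite dirichletE; apply: total_ge0 => x.
have [xab|xab] := boolP (a <= enorm x <= b); last first.
  rewrite /div_sqn (annular_eq0 (annular_euler af) xab) mulr0 mul0r subr0.
  rewrite mulr_ge0 ?invr_ge0 ?sqn_ge0// sumr_ge0// => i _.
  by rewrite -expr2 sqr_ge0.
have x0 : 0 < sqn x by rewrite lt_def (annulus_sqn_neq0 a_gt0 xab) sqn_ge0.
set m := (sqn x)^-1; set E := euler f x.
suff -> : div_sqn (fun y => \sum_i 'd_i f y * 'd_i f y) x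
  - div_sqn (euler f) x * div_sqn (euler f) x
    = m * \sum_i ('d_i f x - m * E * x ord0 i) ^+ 2.
  by rewrite mulr_ge0 ?invr_ge0 ?sqn_ge0// sumr_ge0// => i _; exact: sqr_ge0.
have -> : \sum_i ('d_i f x - m * E * x ord0 i) ^+ 2 =
    \sum_i 'd_i f x * 'd_i f x - 2 * m * E * E + (m * E) ^+ 2 * sqn x.
  have -> : 2 * m * E * E = \sum_i 2 * m * E * (x ord0 i * 'd_i f x).
    by rewrite -mulr_sumr -eulerE.
  have -> : (m * E) ^+ 2 * sqn x = \sum_i (m * E) ^+ 2 * x ord0 i ^+ 2.
    by rewrite /sqn mulr_sumr.
  rewrite -sumrB -big_split/=; apply: eq_bigr => i _.
  by move: m E => *; ring.
by rewrite /div_sqn -/m -/E /m; field; rewrite gt_eqF.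
Qed.

End angular_laplacian.

(** * The Bochner argument *)

Section bochner.
Context {K : realType} {n : nat} (a b : K).
Hypothesis a_gt0 : 0 < a.
Implicit Types (f g h : 'rV[K]_n -> K) (x : 'rV[K]_n) (i j : 'I_n).
Local Notation annular := (annular a b).

Lemma total_le f g : annular f -> annular g -> (forall x, f x <= g x) ->
  total f <= total g.
Proof.
move=> af ag fg; rewrite -subr_ge0 -mulN1r -(total_lin _ ag af).
by apply: total_ge0 => x; rewrite mulN1r subr_ge0.
Qed.

Lemma total_sum2 (F : 'I_n -> 'I_n -> 'rV[K]_n -> K) :
  (forall i j, annular (F i j)) ->
  total (fun x => \sum_i \sum_j F i j x) = \sum_i \sum_j total (F i j).
Proof.
move=> aF; rewrite (total_sum _ (fun i => annular_sum _ (aF i))).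
by apply: eq_bigr => i _; rewrite (total_sum _ (aF i)).
Qed.

(** Integration by parts twice: the squared Laplacian and the squared Hessian
    have the same integral. *)
Lemma total_lap_sqr f : annular f ->
  total (fun x => lap f x * lap f x) =
  total (fun x => \sum_i \sum_j 'd_i ('d_j f) x * 'd_i ('d_j f) x).
Proof.
move=> af; have sf := annular_smooth af.
have a1 i := annular_pd i af.
have a2 i j := annular_pd i (a1 j).
have aM i j k l : annular (fun x => 'd_i ('d_j f) x * 'd_k ('d_l f) x).
  exact: annularM (annular_smooth (a2 i j)) (a2 k l).
transitivity (\sum_i \sum_j total (fun x => 'd_j ('d_j f) x * 'd_i ('d_i f) x)).
  rewrite -(total_sum2 (fun i j => aM j j i i)); congr total; apply/funext => x.
  rewrite lapE mulr_sumr; apply: eq_bigr => i _.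
  by rewrite mulr_suml.
rewrite (total_sum2 (fun i j => aM i j i j)).
apply: eq_bigr => i _; apply: eq_bigr => j _.
transitivity (- total (fun x => 'd_i f x * 'd_i ('d_j ('d_j f)) x)).
  exact: (total_by_parts i (a2 j j) (a1 i)).
transitivity (- - total (fun x => 'd_i ('d_j f) x * 'd_j ('d_i f) x)).
  congr (- _).
  transitivity (total (fun x => 'd_i f x * 'd_j ('d_i ('d_j f)) x)).
    congr total; apply/funext => x; congr (_ * _).
    exact: (pd_comm i j x (annular_smooth (a1 j))).
  exact: (total_by_parts j (a1 i) (a2 i j)).
rewrite opprK; congr total; apply/funext => x; congr (_ * _).
exact: (pd_comm j i x sf).
Qed.

End bochner.

Section spherical_gap.
Context {K : realType} (a b : K).
Hypothesis a_gt0 : 0 < a.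
Local Notation annular := (@annular K 3 a b).
Implicit Types (f : 'rV[K]_3 -> K) (x : 'rV[K]_3).

(** For a symmetric matrix [h] and a vector [x], of image [y] under [h], the
    inequality [(tr k)^2 / 2 <= |k|^2] for the compression [k] of [h] to the plane
    orthogonal to [x], with the denominators cleared: the trace of [k] is
    [t - q / r] and its squared norm is [|h|^2 - 2 |y|^2 / r + q^2 / r^2].  The
    difference of the two sides is [r^-2] times the squared norm of [r^2] times the
    traceless part of [k], whose entries are the [d_i] and [e_ij] of the proof. *)
Lemma tangential_trace_sqr_le (x0 x1 x2 h00 h01 h02 h11 h12 h22 : K) :
  let r := x0 ^+ 2 + x1 ^+ 2 + x2 ^+ 2 in
  let y0 := x0 * h00 + x1 * h01 + x2 * h02 in
  let y1 := x0 * h01 + x1 * h11 + x2 * h12 in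
  let y2 := x0 * h02 + x1 * h12 + x2 * h22 in
  let q := x0 * y0 + x1 * y1 + x2 * y2 in
  let t := h00 + h11 + h22 in
  0 < r ->
  q ^+ 2 + 2 * (r * (y0 ^+ 2 + y1 ^+ 2 + y2 ^+ 2) - q ^+ 2) + (r * t - q) ^+ 2 / 2
  <= r ^+ 2 * (h00 ^+ 2 + h11 ^+ 2 + h22 ^+ 2
    + 2 * (h01 ^+ 2 + h02 ^+ 2 + h12 ^+ 2)).
Proof.
move=> r y0 y1 y2 q t r_gt0.
rewrite -(ler_pM2l (exprn_gt0 2 r_gt0)) -subr_ge0.
pose c := (r * t - q) / 2.
pose d0 := r ^+ 2 * h00 - 2 * r * (x0 * y0) + q * x0 ^+ 2 - c * (r - x0 ^+ 2).
pose d1 := r ^+ 2 * h11 - 2 * r * (x1 * y1) + q * x1 ^+ 2 - c * (r - x1 ^+ 2).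
pose d2 := r ^+ 2 * h22 - 2 * r * (x2 * y2) + q * x2 ^+ 2 - c * (r - x2 ^+ 2).
pose e01 := r ^+ 2 * h01 - r * (x0 * y1 + x1 * y0) + (q + c) * (x0 * x1).
pose e02 := r ^+ 2 * h02 - r * (x0 * y2 + x2 * y0) + (q + c) * (x0 * x2).
pose e12 := r ^+ 2 * h12 - r * (x1 * y2 + x2 * y1) + (q + c) * (x1 * x2).
suff -> : r ^+ 2 * (r ^+ 2 * (h00 ^+ 2 + h11 ^+ 2 + h22 ^+ 2
    + 2 * (h01 ^+ 2 + h02 ^+ 2 + h12 ^+ 2))) -
  r ^+ 2 * (q ^+ 2 + 2 * (r * (y0 ^+ 2 + y1 ^+ 2 + y2 ^+ 2) - q ^+ 2)
    + (r * t - q) ^+ 2 / 2) =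
  d0 ^+ 2 + d1 ^+ 2 + d2 ^+ 2 + 2 * (e01 ^+ 2 + e02 ^+ 2 + e12 ^+ 2).
  move: (sqr_ge0 d0) (sqr_ge0 d1) (sqr_ge0 d2).
  move: (sqr_ge0 e01) (sqr_ge0 e02) (sqr_ge0 e12).
  move: (d0 ^+ 2) (d1 ^+ 2) (d2 ^+ 2) (e01 ^+ 2) (e02 ^+ 2) (e12 ^+ 2) => *.
  by rewrite !addr_ge0// mulr_ge0// !addr_ge0.
(* A polynomial identity in the nine entries. *)
rewrite /d0 /d1 /d2 /e01 /e02 /e12 /c /q /y0 /y1 /y2 /t /r.
by field.
Qed.


Lemma sum_ord3 (F : 'I_3 -> K) :
  \sum_i F i = F ord0 + F (lift ord0 ord0) + F (lift ord0 (lift ord0 ord0)).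
Proof. by rewrite !big_ord_recl big_ord0 addr0 addrA. Qed.

(** With [g = x . grad f - f] the Hessian of [f] maps [x] to [grad g], so the
    quantities of the previous lemma become first order expressions in [g]. *)
Lemma hessian_sqr_ge f x : smooth f -> 0 < sqn x ->
  let g := fun y => euler f y + (-1) * f y in
  div_sqn (euler g) x ^+ 2
  + 2 * (div_sqn (fun y => \sum_i 'd_i g y * 'd_i g y) x - div_sqn (euler g) x ^+ 2)
  + div_sqn (fun y => sqn y * lap f y + (-1) * euler g y) x ^+ 2 / 2
  <= \sum_i \sum_j 'd_i ('d_j f) x * 'd_i ('d_j f) x.
Proof.
move=> sf x0; cbv zeta; set g := fun y => euler f y + (-1) * f y.
have sef := smooth_euler sf.
have dg i : 'd_i g x = euler ('d_i f) x.
  rewrite /g (pdD i x sef (smoothZ _ sf)) (pdZ _ _ _ sf) (pd_euler _ _ sf).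
  by rewrite mulN1r addrC addKr.
have Eg : euler g x = \sum_i x ord0 i * euler ('d_i f) x.
  by rewrite eulerE; apply: eq_bigr => i _; rewrite dg.
pose i0 : 'I_3 := ord0; pose i1 : 'I_3 := lift ord0 ord0.
pose i2 : 'I_3 := lift ord0 (lift ord0 ord0).
have := @tangential_trace_sqr_le (x ord0 i0) (x ord0 i1) (x ord0 i2)
  ('d_i0 ('d_i0 f) x) ('d_i0 ('d_i1 f) x) ('d_i0 ('d_i2 f) x)
  ('d_i1 ('d_i1 f) x) ('d_i1 ('d_i2 f) x) ('d_i2 ('d_i2 f) x).
have H i j : 'd_i ('d_j f) x = 'd_j ('d_i f) x by exact: pd_comm.
have sE : x ord0 i0 ^+ 2 + x ord0 i1 ^+ 2 + x ord0 i2 ^+ 2 = sqn x.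
  by rewrite /sqn sum_ord3.
rewrite sE => /= /(_ x0).
have y0E : euler ('d_i0 f) x = x ord0 i0 * 'd_i0 ('d_i0 f) x
    + x ord0 i1 * 'd_i0 ('d_i1 f) x + x ord0 i2 * 'd_i0 ('d_i2 f) x.
  by rewrite !eulerE sum_ord3 -/i0 -/i1 -/i2 (H i1 i0) (H i2 i0).
have y1E : euler ('d_i1 f) x = x ord0 i0 * 'd_i0 ('d_i1 f) x
    + x ord0 i1 * 'd_i1 ('d_i1 f) x + x ord0 i2 * 'd_i1 ('d_i2 f) x.
  by rewrite !eulerE sum_ord3 -/i0 -/i1 -/i2 (H i2 i1).
have y2E : euler ('d_i2 f) x = x ord0 i0 * 'd_i0 ('d_i2 f) x
    + x ord0 i1 * 'd_i1 ('d_i2 f) x + x ord0 i2 * 'd_i2 ('d_i2 f) x.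
  by rewrite !eulerE sum_ord3.
rewrite -y0E -y1E -y2E.
have qE : euler g x = x ord0 i0 * euler ('d_i0 f) x
    + x ord0 i1 * euler ('d_i1 f) x + x ord0 i2 * euler ('d_i2 f) x.
  by rewrite Eg sum_ord3.
have tE : lap f x = 'd_i0 ('d_i0 f) x + 'd_i1 ('d_i1 f) x + 'd_i2 ('d_i2 f) x.
  by rewrite lapE sum_ord3.
rewrite -qE -tE.
have gE : \sum_i 'd_i g x * 'd_i g x = euler ('d_i0 f) x ^+ 2
    + euler ('d_i1 f) x ^+ 2 + euler ('d_i2 f) x ^+ 2.
  by rewrite sum_ord3 !dg.
have hE : \sum_i \sum_j 'd_i ('d_j f) x * 'd_i ('d_j f) x =
    'd_i0 ('d_i0 f) x ^+ 2 + 'd_i1 ('d_i1 f) x ^+ 2 + 'd_i2 ('d_i2 f) x ^+ 2 +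
    2 * ('d_i0 ('d_i1 f) x ^+ 2 + 'd_i0 ('d_i2 f) x ^+ 2 + 'd_i1 ('d_i2 f) x ^+ 2).
  rewrite !sum_ord3 -/i0 -/i1 -/i2 (H i1 i0) (H i2 i0) (H i2 i1).
  by move: ('d_i0 ('d_i1 f) x) => ?; ring.
rewrite -gE -hE /div_sqn.
move: (\sum_i _) (\sum_i _) (euler g x) (lap f x) (sqn x) x0 => G HH q t r r0 le.
rewrite -(ler_pM2l (exprn_gt0 2 r0)); apply: le_trans le; rewrite le_eqVlt.
by apply/orP; left; apply/eqP; field; rewrite gt_eqF.
Qed.

End spherical_gap.

(** * The Laplacian dominates its radial part *)

Section rellich_inequality.
Context {K : realType} (a b : K).
Hypothesis a_gt0 : 0 < a.

Let ip_angularE n := @ip_angular K n a b a_gt0.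
Let ip_linlE n := @ip_linl K n a b a_gt0.
Let ip_linrE n := @ip_linr K n a b a_gt0.

Section any_dimension.
Context {n : nat}.
Implicit Types (f g : 'rV[K]_n -> K) (x : 'rV[K]_n).
Local Notation annular := (@annular K n a b).

(** The angular part is symmetric and commutes with the Euler field, which is
    itself antisymmetric up to the constant [4 - n]. *)
Lemma dirichlet_euler f : annular f ->
  [/\ ip (euler f) (angular_part f) *+ 2 = (4 - n%:R) * dirichlet f f &
      ip (euler (euler f)) (angular_part f) =
      (4 - n%:R) * ip (euler f) (angular_part f) - dirichlet (euler f) (euler f)].
Proof.
move=> af; have ae := annular_euler af; have aA := annular_angular_part af.
have sf := annular_smooth af.
have EA : euler (angular_part f) = angular_part (euler f).
  by apply/funext => x; exact: angular_euler.
have sym : ip f (angular_part (euler f)) = ip (euler f) (angular_part f).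
  by rewrite !ip_angularE // dirichletC.
split.
  have := ip_euler a_gt0 af aA.
  by rewrite EA sym (ip_angularE af af) mulr2n.
have := ip_euler a_gt0 ae aA.
by rewrite EA (ip_angularE ae ae) => <-; rewrite addrK.
Qed.

Lemma div_sqn_sqn_lap f x : annular f ->
  div_sqn (fun y => sqn y * lap f y) x = lap f x.
Proof.
move=> af; rewrite -[RHS](sqn_div_sqn a_gt0 x (annular_lap af)) /div_sqn.
by rewrite mulrCA.
Qed.

Lemma total_lap_ip f : annular f ->
  total (fun x => lap f x ^+ 2) =
  ip (fun x => radial_part f x + (-1) * angular_part f x)
     (fun x => radial_part f x + (-1) * angular_part f x).
Proof.
move=> af; rewrite ipE; congr total; apply/funext => x.
rewrite -expr2 -(div_sqn_sqn_lap x af) /div_sqn; congr ((_ * _) ^+ 2).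
by rewrite angular_partE mulN1r opprB addrC subrK.
Qed.

(** The square of [radial_part f - angular_part f] is expanded, and the mixed
    term is expressed by [dirichlet_euler]. *)
Lemma total_lap_decomposition f : annular f ->
  total (fun x => lap f x ^+ 2) =
  ip (radial_part f) (radial_part f) + ip (angular_part f) (angular_part f)
  + 2 * (n%:R - 4) * dirichlet f f + 2 * dirichlet (euler f) (euler f).
Proof.
move=> af; have ae := annular_euler af; have aee := annular_euler ae.
have aP := annular_radial_part af; have aA := annular_angular_part af.
have aPA := annularD aP (annularZ (-1) aA).
rewrite (total_lap_ip af) (ip_linlE _ aP aA aPA).
rewrite !(ip_linrE _ aP aA) // [ip (angular_part f) (radial_part f)]ipC.
have PA : ip (radial_part f) (angular_part f) =
    ip (euler (euler f)) (angular_part f) + (n%:R - 2) * ip (euler f) (angular_part f).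
  by rewrite (funext (radial_partE f)) (ip_linlE _ aee ae aA).
have [E1 E2] := dirichlet_euler af; rewrite PA E2.
move: E1 (ip (radial_part f) _) (ip (angular_part f) _) (dirichlet (euler f) _).
move: (ip _ _) (dirichlet _ _) => u d E1 p w e; rewrite mulr2n in E1.
have -> : 2 * (n%:R - 4) * d = - 2 * ((4 - n%:R) * d) by ring.
by rewrite -E1; ring.
Qed.

Lemma angular_part_lin c f g x : smooth f -> smooth g ->
  angular_part (fun y => f y + c * g y) x = angular_part f x + c * angular_part g x.
Proof.
move=> sf sg; have scg := smoothZ c sg.
have eE (h1 h2 : 'rV[K]_n -> K) : smooth h1 -> smooth h2 ->
    euler (fun y => h1 y + c * h2 y) = fun y => euler h1 y + c * euler h2 y.
  move=> s1 s2; apply/funext => y.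
  by rewrite (eulerD _ s1 (smoothZ c s2)) (eulerZ _ _ s2).
have dE i (h1 h2 : 'rV[K]_n -> K) : smooth h1 -> smooth h2 ->
    'd_i (fun y => h1 y + c * h2 y) = fun y => 'd_i h1 y + c * 'd_i h2 y.
  move=> s1 s2; apply/funext => y.
  by rewrite (pdD i _ s1 (smoothZ c s2)) (pdZ _ _ _ s2).
have lE : lap (fun y => f y + c * g y) x = lap f x + c * lap g x.
  rewrite !lapE mulr_sumr -big_split/=; apply: eq_bigr => i _.
  by rewrite (dE i _ _ sf sg) (dE i _ _ (smooth_pd i sf) (smooth_pd i sg)).
rewrite !angular_partE !radial_partE lE (eE _ _ sf sg).
rewrite (eE _ _ (smooth_euler sf) (smooth_euler sg)).
by move: (euler (euler f) x) (euler (euler g) x) => *; ring.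
Qed.

End any_dimension.

(** The spectral gap of the sphere in dimension three.  The integrated lower
    bound for the Hessian, combined with [total_lap_sqr] and the decomposition
    above, loses all its radial terms. *)
Lemma angular_gap (f : 'rV[K]_3 -> K) : annular a b f ->
  2 * dirichlet f f <= ip (angular_part f) (angular_part f).
Proof.
move=> af; have ae := annular_euler af; have aee := annular_euler ae.
have aA := annular_angular_part af; have sf := annular_smooth af.
(* In dimension three, [radial_part f = euler g + 2 euler f] and [|x|^2]
   times the tangential trace of the Hessian is [r = 2 euler f - angular_part f]. *)
pose g x := euler f x + (-1) * f x.
have ag : annular a b g := annularD ae (annularZ (-1) af).
pose r x := sqn x * lap f x + (-1) * euler g x.
have aeg := annular_euler ag.
have ar : annular a b r.
  apply: annularD; last exact: annularZ.
  by apply: annularM; [exact: smooth_sqn|exact: annular_lap].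
have a1 i := annular_pd i af; have a2 i j := annular_pd i (a1 j).
have bochner : ip (euler g) (euler g) + 2 * dirichlet g g + 2^-1 * ip r r <=
    total (fun x => lap f x ^+ 2).
  have aw := annular_div_sqnM a_gt0 aeg aeg.
  have ad : annular a b (fun x => div_sqn (fun y => \sum_i 'd_i g y * 'd_i g y) x -
      div_sqn (euler g) x * div_sqn (euler g) x).
    exact: annularB (annular_div_sqn a_gt0 (annular_grad ag ag)) aw.
  have awr := annular_div_sqnM a_gt0 ar ar.
  rewrite !ipE dirichletE -(total_lin 2 aw ad) -(total_lin _ (annularD aw (annularZ 2 ad)) awr).
  have aH : annular a b (fun x => \sum_i \sum_j 'd_i ('d_j f) x * 'd_i ('d_j f) x).
    apply: annular_sum => i; apply: annular_sum => j.
    exact: annularM (annular_smooth (a2 i j)) (a2 i j).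
  under [X in _ <= total X]eq_fun do rewrite expr2.
  rewrite (total_lap_sqr af).
  apply: (total_le _ aH) => [|x].
    exact: annularD (annularD aw (annularZ 2 ad)) (annularZ 2^-1 awr).
  have [xab|xab] := boolP (a <= enorm x <= b).
    have x0 : 0 < sqn x by rewrite lt_def (annulus_sqn_neq0 a_gt0 xab) sqn_ge0.
    have := hessian_sqr_ge sf x0; cbv zeta; rewrite -/g -/r => le.
    by apply: le_trans le; rewrite !expr2 [2^-1 * _]mulrC.
  have w0 h : annular a b h -> div_sqn h x = 0.
    by move=> ah; rewrite /div_sqn (annular_eq0 ah xab) mulr0.
  rewrite (annular_eq0 ad xab) !(w0 _ ar) (w0 _ aeg) !mulr0 !addr0.
  by apply: sumr_ge0 => i _; apply: sumr_ge0 => j _; rewrite -expr2 sqr_ge0.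
rewrite total_lap_decomposition// in bochner.
have qE : euler g = fun x => euler (euler f) x + (-1) * euler f x.
  by apply/funext => x; rewrite (eulerD _ (annular_smooth ae) (smoothZ _ sf)) (eulerZ _ _ sf).
have PE : radial_part f = fun x => euler g x + 2 * euler f x.
  by apply/funext => x; rewrite qE radial_partE; ring.
have rE : r = fun x => 2 * euler f x + (-1) * angular_part f x.
  by apply/funext => x; rewrite /r qE !angular_partE !radial_partE; ring.
have [E1 E2] := dirichlet_euler af.
have E3 := ip_euler a_gt0 ae ae.
have a2e := annularZ 2 ae.
have gg : dirichlet g g = dirichlet (euler f) (euler f)
    - 2 * ip (euler f) (angular_part f) + dirichlet f f.
  have AgE : angular_part g = fun x => angular_part (euler f) x + (-1) * angular_part f x.
    by apply/funext => x; exact: angular_part_lin _ _ (annular_smooth ae) sf.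
  have aAe := annular_angular_part ae.
  rewrite -(ip_angularE ag ag) AgE (ip_linlE _ ae af (annularD aAe (annularZ (-1) aA))).
  rewrite (ip_linrE _ aAe aA ae) (ip_linrE _ aAe aA af).
  rewrite (ip_angularE ae ae) (ip_angularE af ae) (ip_angularE af af).
  rewrite (dirichletC f (euler f)) -(ip_angularE ae af).
  by move: (dirichlet (euler f) _) (dirichlet f _) (ip _ _) => *; ring.
have rr : ip r r = 4 * ip (euler f) (euler f) - 4 * ip (euler f) (angular_part f)
    + ip (angular_part f) (angular_part f).
  rewrite rE (ip_linlE _ a2e aA (annularD a2e (annularZ (-1) aA))).
  rewrite (ip_linrE _ a2e aA a2e) (ip_linrE _ a2e aA aA).
  rewrite (ipZl a_gt0 2 ae a2e) (ipZl a_gt0 2 ae aA).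
  rewrite (ipZr a_gt0 2 ae ae) (ipZr a_gt0 2 ae aA) (ipC (angular_part f) (euler f)).
  by move: (ip _ _) (ip _ _) (ip _ _) => *; ring.
have PP : ip (radial_part f) (radial_part f) = ip (euler g) (euler g)
    + 4 * ip (euler g) (euler f) + 4 * ip (euler f) (euler f).
  rewrite PE (ip_linlE _ aeg ae); last exact: annularD.
  rewrite !(ip_linrE _ aeg ae)// (ipC (euler f) (euler g)).
  by ring.
have ge : ip (euler g) (euler f) = ip (euler (euler f)) (euler f) - ip (euler f) (euler f).
  by rewrite qE (ip_linlE _ aee ae ae) mulN1r.
rewrite PP ge gg rr in bochner.
rewrite (ipC (euler f) (euler (euler f))) in E3.
move: bochner E1 E2 E3.
move: (ip (euler g) _) (ip (angular_part f) _) (ip (euler (euler f)) (euler f)).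
move: (ip (euler f) (euler f)) (ip (euler f) _) (dirichlet f _) (dirichlet (euler f) _).
move: (ip _ _) => u e eA d de q A ee.
by rewrite (mulr2n eA) => *; lra.
Qed.

(** In dimension at least four every term of the decomposition besides the
    radial one is nonnegative.  In dimension three the term [-2 dirichlet f f] is
    compensated by the spectral gap. *)
Theorem rellich_radial_part n (f : 'rV[K]_n -> K) : (3 <= n)%N -> annular a b f ->
  total (fun x => div_sqn (radial_part f) x ^+ 2) <= total (fun x => lap f x ^+ 2).
Proof.
move=> n3 af; rewrite (total_lap_decomposition af).
have -> : total (fun x => div_sqn (radial_part f) x ^+ 2) = ip (radial_part f) (radial_part f).
  by rewrite ipE; congr total; apply/funext => x; rewrite expr2.
have de := dirichlet_ge0 a_gt0 (annular_euler af).
have dA := ip_ge0 (angular_part f).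
rewrite -!addrA lerDl.
have [n4|n4] := leqP 4 n.
  have df := dirichlet_ge0 a_gt0 af.
  rewrite addr_ge0// addr_ge0// ?mulr_ge0// subr_ge0.
  by rewrite (ler_nat K 4 n).
have n3E : n = 3%N by apply/eqP; rewrite eqn_leq n3 andbT -ltnS.
subst n; have := angular_gap af.
move: (ip _ _) (dirichlet _ _) (dirichlet _ _) de dA => w d e *.
lra.
Qed.

End rellich_inequality.

(** * Radial functions built from rays *)

Section chain_rule.
Context {K : realType} {V : normedModType K}.
Implicit Types (g : V -> K) (x v : V).

Lemma is_derive_line0 g x v d :
  is_derive (0 : K) 1 (fun s : K => g (s *: v + x)) d -> is_derive x v g d.
Proof.
have E : (fun h : K => h^-1 *: (((fun s : K => g (s *: v + x)) \o shift 0) (h *: 1)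
                       - g (0 *: v + x))) =
         (fun h : K => h^-1 *: ((g \o shift x) (h *: v) - g x)).
  by apply/funext => h /=; rewrite [h *: 1]mulr1 addr0 scale0r add0r.
by case=> dg <-; split; [move: dg; rewrite /derivable E|rewrite /derive E].
Qed.

Lemma is_derive_comp (f : K -> K) g x v (c d : K) :
  is_derive (g x) 1 f c -> is_derive x v g d ->
  is_derive x v (fun y => f (g y)) (c * d).
Proof.
move=> df dg; apply: is_derive_line0.
apply: (@is_derive1_comp _ f (fun s => g (s *: v + x))); first by rewrite scale0r add0r.
by apply: is_derive_line; rewrite scale0r add0r.
Qed.

End chain_rule.

Section ray_functions.
Context {K : realType} {n : nat} (a b : K).
Hypothesis a_gt0 : 0 < a.
Variable w : 'rV[K]_n.
Hypothesis w1 : enorm w = 1.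
Implicit Types (f : 'rV[K]_n -> K) (x : 'rV[K]_n).
Local Notation annular := (annular a b).
Local Notation e_ i := (delta_mx ord0 i : 'rV[K]_n).

(** The radial function that takes on each sphere the value of [f] in the
    direction [w]. *)
Definition ray f x := f (enorm x *: w).

Lemma enormZ (c : K) x : enorm (c *: x) = `|c| * enorm x.
Proof.
rewrite /enorm -sqrtr_sqr -sqrtrM ?sqr_ge0//; congr Num.sqrt.
by rewrite mulr_sumr; apply: eq_bigr => i _; rewrite mxE exprMn.
Qed.

Lemma enorm_ray x : enorm (enorm x *: w) = enorm x.
Proof. by rewrite enormZ w1 mulr1 ger0_norm// enorm_ge0. Qed.

Lemma sqn_ray x : sqn (enorm x *: w) = sqn x.
Proof. by rewrite -enorm_sqr enorm_ray enorm_sqr. Qed.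

Lemma ray_support f x : annular f -> ray f x != 0 -> a <= enorm x <= b.
Proof. by move=> af /(annular_support af); rewrite enorm_ray. Qed.

Lemma ray_eq0 f x : annular f -> ~~ (a <= enorm x <= b) -> ray f x = 0.
Proof. by move=> af; apply: contraNeq; exact: ray_support. Qed.

Lemma is_derive_enorm x i : enorm x != 0 ->
  is_derive x (e_ i) (@enorm K n) (x ord0 i / enorm x).
Proof.
move=> x0; have q0 : 0 < sqn x by rewrite -enorm_sqr exprn_gt0// lt_def x0 enorm_ge0.
have dq := smooth_is_derive i x (@smooth_sqn K n).
have de : is_derive x (e_ i) (@enorm K n) ((2 * enorm x)^-1 * 'd_i sqn x).
  exact: (is_derive_comp (is_derive1_sqrt q0) dq).
by apply: (is_derive_eq de); rewrite pd_sqn; field.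
Qed.

Lemma is_derive_ray f x i : annular f ->
  is_derive x (e_ i) (ray f) (x ord0 i * ray (div_sqn (euler f)) x).
Proof.
move=> af; have awe := annular_div_sqn a_gt0 (annular_euler af).
have [xab|xab] := boolP (a <= enorm x <= b); last first.
  rewrite (ray_eq0 awe xab) mulr0; apply: is_derive_near0.
  by apply: vanish_near0 xab => y; exact: ray_support.
have x0 : enorm x != 0.
  by move: xab => /andP[ax _]; rewrite gt_eqF// (lt_le_trans a_gt0).
set t := enorm x; have sf := annular_smooth af.
have [df dE] := smooth_directional (t *: w) w sf.
have dray : is_derive t 1 (fun s : K => f (s *: w)) (\sum_j w ord0 j * 'd_j f (t *: w)).
  rewrite (_ : (fun s : K => f (s *: w)) = fun s : K => f (s *: w + 0)); last first.
    by apply/funext => s; rewrite addr0.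
  apply: is_derive_line; rewrite addr0; split => //; exact: diff_derivable.
apply: (is_derive_eq (is_derive_comp dray (is_derive_enorm i x0))).
rewrite /ray /div_sqn eulerE sqn_ray -enorm_sqr -/t.
have -> : \sum_j (t *: w) ord0 j * 'd_j f (t *: w) =
    t * \sum_j w ord0 j * 'd_j f (t *: w).
  by rewrite mulr_sumr; apply: eq_bigr => j _; rewrite mxE mulrA.
by field.
Qed.

Lemma continuous_ray f : annular f -> continuous (ray f).
Proof.
move=> af x; apply: (@continuous_comp _ _ _ (fun y => enorm y *: w) f).
  by apply: continuousZr_tmp; exact: (@continuous_enorm K n x).
exact: smooth_continuous (annular_smooth af) _.
Qed.

(** A partial derivative of [ray f] is a coordinate times [ray] of an annular
    function, so [ray] functions and coordinates generate a stable ring. *)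
Lemma annular_ray f : annular f -> annular (ray f).
Proof.
move=> af; split; last by move=> x; exact: ray_support.
pose B g := exists2 h, annular h & g = ray h.
apply: (@smooth_generated _ _ B); last by apply: gen_base; exists f.
move=> _ [h ah ->]; split; first exact: continuous_ray.
  by move=> i x; exact: (@ex_derive _ _ _ _ _ _ _ (is_derive_ray x i ah)).
move=> i; rewrite (_ : 'd_i (ray h) = fun x => x ord0 i * ray (div_sqn (euler h)) x).
  apply: gen_mul; first by apply: gen_smooth; exact: smooth_coord.
  by apply: gen_base; exists (div_sqn (euler h)) => //; exact/annular_div_sqn/annular_euler.
by apply/funext => x; apply: pd_val; exact: is_derive_ray.
Qed.

Lemma pd_ray f i x : annular f -> 'd_i (ray f) x = x ord0 i * ray (div_sqn (euler f)) x.
Proof. by move=> af; apply: pd_val; exact: is_derive_ray. Qed.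

Lemma lap_ray f x : annular f -> lap (ray f) x = ray (div_sqn (radial_part f)) x.
Proof.
move=> af; have aE := annular_euler af.
have aw := annular_div_sqn a_gt0 aE.
have awE := annular_div_sqn a_gt0 (annular_euler aw).
have awr := annular_div_sqn a_gt0 (annular_radial_part af).
have [xab|xab] := boolP (a <= enorm x <= b); last first.
  rewrite (ray_eq0 awr xab) lapE big1// => i _.
  exact: annular_eq0 (annular_pd i (annular_pd i (annular_ray af))) xab.
have q0 := annulus_sqn_neq0 a_gt0 xab.
have ddE i : 'd_i ('d_i (ray f)) x =
    x ord0 i ^+ 2 * ray (div_sqn (euler (div_sqn (euler f)))) x + ray (div_sqn (euler f)) x.
  rewrite (_ : 'd_i (ray f) = fun y => y ord0 i * ray (div_sqn (euler f)) y); last first.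
    by apply/funext => y; exact: pd_ray.
  rewrite (pdM _ _ (smooth_coord i) (annular_smooth (annular_ray aw))) pd_coord eqxx mulr1.
  by rewrite pd_ray// mulrA expr2.
rewrite lapE; under eq_bigr do rewrite ddE.
rewrite big_split/= -mulr_suml sumr_const card_ord -[\sum_i _]/(sqn x).
rewrite {1 2}/ray [div_sqn (euler (div_sqn _)) _]/div_sqn (euler_div_sqn a_gt0 _ aE) sqn_ray.
rewrite mulrA mulfV// mul1r /ray /div_sqn radial_partE -mulr_natl; ring.
Qed.

End ray_functions.

(** * Averaging over directions *)

Section polar_average.
Context {K : realType} {n : nat}.
Hypothesis n_gt0 : (0 < n)%N.
Local Notation mu := (@lebesgue_rV K n).
Local Notation r := (@enorm K n).
Implicit Types (g : 'rV[K]_n -> K) (x y z : 'rV[K]_n).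

(** The indicator of the radii in [[1, 2n]]; this shell contains the cube of all
    points with coordinates in [[1, 2]], hence has positive volume. *)
Definition shell (t : K) : K := \1_`[1, 2 * n%:R]%classic t.

Lemma shell_ge0 t : 0 <= shell t.
Proof. by rewrite /shell indicE. Qed.

Lemma shell0 : shell 0 = 0.
Proof. by rewrite /shell indicE memNset//= in_itv/= ler10. Qed.

Lemma measurable_shell : measurable_fun setT (shell : measurableTypeR K -> measurableTypeR K).
Proof. exact: measurable_indic. Qed.

Lemma measurable_enorm : measurable_fun setT (r : _ -> measurableTypeR K).
Proof. by apply: continuous_measurable_rV; exact: continuous_enorm. Qed.

Lemma measurable_enormV : measurable_fun setT ((fun y => (r y)^-1) : _ -> measurableTypeR K).
Proof.
rewrite (_ : (fun y => _) = fun y => r y `^ (-1)); last first.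
  by apply/funext => y; rewrite powR_inv1// enorm_ge0.
exact: (measurableT_comp (measurable_powR (-1)) measurable_enorm).
Qed.

Lemma measurable_scale d (T : measurableType d) (s : T -> measurableTypeR K)
    (v : T -> 'rV[K]_n) : measurable_fun setT s -> measurable_fun setT v ->
  measurable_fun setT (fun t => s t *: v t).
Proof.
move=> ms mv; apply/measurable_fun_rVP => i; under eq_fun do rewrite mxE.
apply: measurable_funM => //.
exact: (measurableT_comp (measurable_rV_coord i) mv).
Qed.

Definition shell_mass : \bar K := (\int[mu]_v (shell (r v))%:E)%E.

Lemma shell_mass_fin : shell_mass \is a fin_num.
Proof.
have ms : measurable_fun setT ((fun v => shell (r v)) : _ -> measurableTypeR K).
  exact: measurableT_comp measurable_shell measurable_enorm.
apply: integrable_fin_num => //; apply: (@integrable_bounded_box _ _ (2 * n%:R) 1) => //.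
  by move=> x; rewrite /shell indicE; case: (_ \in _); rewrite ?normr1 ?normr0.
move=> x; rewrite /shell indicE; have [|] := boolP (r x \in _); last by rewrite eqxx.
rewrite inE/= in_itv/= => /andP[_ rx] _ i.
exact: le_trans (coord_le_enorm x i) rx.
Qed.

Lemma shell_mass_gt0 : (0 < shell_mass)%E.
Proof.
pose Q : set 'rV[K]_n := [set x | forall i, `[1, 2]%classic (x ord0 i)].
have mQ : measurable Q.
  rewrite (_ : Q = \bigcap_(i in [set: 'I_n])
      ((fun x : 'rV[K]_n => x ord0 i) @^-1` `[1, 2]%classic)).
    apply: fin_bigcap_measurable => // i _.
    by rewrite -[X in measurable X]setTI; apply: measurable_rV_coord.
  by apply/seteqP; split=> x /= xQ i; [move=> _|]; exact: xQ.
have muQ : mu Q = 1%E.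
  rewrite (lebesgue_rV_box (A := fun=> `[1, 2]%classic))// big1// => i _.
  by rewrite lebesgue_measure_itv/= lte_fin ltr1n -EFinD; congr EFin; ring.
apply: (@lt_le_trans _ _ 1%E); first exact: lte01.
rewrite -muQ -(setIT Q) -integral_indic//; apply: ge0_le_integral => //.
- by apply/measurable_EFinP; exact: measurable_indic.
- by apply/measurable_EFinP; exact: measurableT_comp measurable_shell measurable_enorm.
move=> x _; rewrite lee_fin /shell !indicE; have [xQ|//] := boolP (x \in Q).
rewrite mem_set//=; move: xQ; rewrite inE => xQ.
have q1 i : 1 <= x ord0 i ^+ 2.
  by have /= := xQ i; rewrite in_itv/= => /andP[x1 _]; rewrite exprn_ege1.
have q2 i : x ord0 i ^+ 2 <= 4.
  have /= := xQ i; rewrite in_itv/= => /andP[x1 x2].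
  by nra.
have N1 : 1 <= n%:R :> K by rewrite ler1n.
have s1 : n%:R <= sqn x.
  by rewrite -[n in n%:R]card_ord -sumr_const; apply: ler_sum.
have s2 : sqn x <= 4 * n%:R.
  by rewrite mulr_natr -[n in _ *+ n]card_ord -sumr_const; apply: ler_sum.
have r2 : 0 <= 2 * n%:R :> K by rewrite mulr_ge0.
rewrite in_itv/=; apply/andP; split.
  rewrite -(@ler_pXn2r _ 2)// ?nnegrE ?enorm_ge0// expr1n enorm_sqr.
  exact: le_trans s1.
rewrite -(@ler_pXn2r _ 2)// ?nnegrE ?enorm_ge0// enorm_sqr (le_trans s2)//.
by rewrite exprMn -natrX ler_pM2l// expr2 ler_peMl.
Qed.

(** Integration in polar coordinates without a measure on the sphere.  The
    direction is [y / |y|], with [y] distributed along a radial weight.  For fixed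
    [y] put [x = |y| z]; exchange the integrals; for fixed [z] put [w = |z| y];
    exchange again: the integrals separate, and the weight has been chosen so
    that the one in [z] is the volume of a shell. *)
Lemma polar_integral g : measurable_fun setT (g : _ -> measurableTypeR K) ->
  (forall x, 0 <= g x) -> g 0 = 0 ->
  (\int[mu]_y (((r y)^-1 ^+ (n + n) * shell (r y)^-1)%:E *
     \int[mu]_x (g (r x *: ((r y)^-1 *: y)))%:E) =
   shell_mass * \int[mu]_x (g x)%:E)%E.
Proof.
move=> mg g0 g00.
have mE1 : measurable_fun setT (fun p : 'rV[K]_n * 'rV[K]_n => r p.1 : measurableTypeR K).
  exact: measurableT_comp measurable_enorm measurable_fst.
have mE2 : measurable_fun setT (fun p : 'rV[K]_n * 'rV[K]_n => r p.2 : measurableTypeR K).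
  exact: measurableT_comp measurable_enorm measurable_snd.
have mV2 : measurable_fun setT (fun p : 'rV[K]_n * 'rV[K]_n => (r p.2)^-1 : measurableTypeR K).
  exact: measurableT_comp measurable_enormV measurable_snd.
(* [H (z, y)] and [G (z, w)] are the integrands after the first and the second
   substitution. *)
pose H (p : 'rV[K]_n * 'rV[K]_n) :=
  (r p.2)^-1 ^+ n * shell (r p.2)^-1 * g (r p.1 *: p.2).
pose G (p : 'rV[K]_n * 'rV[K]_n) :=
  (r p.2)^-1 ^+ n * shell (r p.1 * (r p.2)^-1) * g p.2.
have mH : measurable_fun setT (EFin \o H).
  apply/measurable_EFinP; apply: measurable_funM; first apply: measurable_funM.
  - exact: measurable_funX.
  - exact: (measurableT_comp measurable_shell mV2).
  - by apply: (measurableT_comp mg); exact: measurable_scale.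
have mG : measurable_fun setT (EFin \o G).
  apply/measurable_EFinP; apply: measurable_funM; first apply: measurable_funM.
  - exact: measurable_funX.
  - by apply: (measurableT_comp measurable_shell); exact: measurable_funM.
  - exact: (measurableT_comp mg measurable_snd).
have V0 x : 0 <= (r x)^-1 by rewrite invr_ge0 enorm_ge0.
have H0 p : (0 <= (EFin \o H) p)%E.
  by rewrite lee_fin !mulr_ge0 ?shell_ge0// exprn_ge0.
have G0 p : (0 <= (EFin \o G) p)%E.
  by rewrite lee_fin !mulr_ge0 ?shell_ge0// exprn_ge0.
have scale0 (l : K) (h : 'rV[K]_n -> \bar K) : 0 < l -> measurable_fun setT h ->
    (forall x, 0 <= h x)%E ->
    (\int[mu]_x h (l *: x)%R = (l ^- n)%:E * \int[mu]_x h x)%E.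
  move=> l0 mh h0; rewrite -(ge0_integral_affine 0 l0 mh h0).
  by under [RHS]eq_integral do rewrite addr0.
transitivity (\int[mu]_y \int[mu]_z (EFin \o H) (z, y))%E.
  apply: eq_integral => y _; have [ry0|ry0] := eqVneq (r y) 0.
    rewrite ry0 invr0 shell0 mulr0 mul0e integral0_eq// => z _.
    by rewrite /H /= ry0 invr0 shell0 mulr0 mul0r.
  have ry : 0 < r y by rewrite lt_def ry0 enorm_ge0.
  set h := fun x : 'rV[K]_n => (g (r x *: ((r y)^-1 *: y)))%:E.
  have mh : measurable_fun setT h.
    apply/measurable_EFinP; apply: (measurableT_comp mg).
    by apply: measurable_scale; [exact: measurable_enorm|exact: measurable_cst].
  have h0 x : (0 <= h x)%E by rewrite lee_fin.
  have -> : (\int[mu]_x h x = (r y ^+ n)%:E * \int[mu]_x h (r y *: x)%R)%E.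
    by rewrite scale0// muleA -EFinM mulfV ?expf_neq0// mul1e.
  have hE x : h (r y *: x) = (g (r x *: y))%:E.
    rewrite /h enormZ ger0_norm// ?enorm_ge0// scalerA.
    by rewrite (mulrC (r y)) -mulrA mulfV// mulr1.
  under eq_integral do rewrite hE.
  rewrite muleA -EFinM -ge0_integralZl//.
  - apply: eq_integral => z _; rewrite -EFinM /H /= exprD.
    congr (EFin (_ * _)); rewrite mulrAC -(mulrA _ _ (r y ^+ n)) -exprMn.
    by rewrite mulVf// expr1n mulr1.
  - apply/measurable_EFinP; apply: (measurableT_comp mg).
    by apply: measurable_scale; [exact: measurable_enorm|exact: measurable_cst].
  - by move=> x _; rewrite lee_fin.
  - by rewrite lee_fin !mulr_ge0 ?shell_ge0 ?exprn_ge0 ?enorm_ge0.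
rewrite -(fubini_tonelli (EFin \o H))//.
transitivity (\int[mu]_z \int[mu]_w (EFin \o G) (z, w))%E.
  apply: eq_integral => z _; have [rz0|rz0] := eqVneq (r z) 0.
    rewrite !integral0_eq// => y _; rewrite /G /H /= rz0.
      by rewrite mul0r shell0 mulr0 mul0r.
    by rewrite scale0r g00 mulr0.
  have rz : 0 < r z by rewrite lt_def rz0 enorm_ge0.
  pose h y := ((r z ^+ n)%:E * (EFin \o G) (z, y))%E.
  have mGz : measurable_fun setT (fun y => (EFin \o G) (z, y)).
    exact: (measurableT_comp mG (pair1_measurable z)).
  have mh : measurable_fun setT h by exact: measurable_funeM.
  have h0 y : (0 <= h y)%E by rewrite mule_ge0// lee_fin exprn_ge0// ltW.
  transitivity (\int[mu]_y h (r z *: y)%R)%E.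
    apply: eq_integral => y _; rewrite /h /H /G /= -EFinM enormZ gtr0_norm//.
    congr EFin; rewrite invfM exprMn mulrA mulrA mulrA; congr (_ * shell _ * _).
      by rewrite -exprMn mulfV// expr1n mul1r.
    by rewrite mulrA mulfV// mul1r.
  rewrite scale0// /h ge0_integralZl//; last by rewrite lee_fin exprn_ge0// ltW.
  by rewrite muleA -EFinM mulVf ?mul1e// expf_neq0.
rewrite (fubini_tonelli (EFin \o G))//.
rewrite muleC -ge0_integralZr//; last 3 first.
- exact/measurable_EFinP.
- by move=> x _; rewrite lee_fin.
- exact: ltW shell_mass_gt0.
apply: eq_integral => w _; have [rw0|rw0] := eqVneq (r w) 0.
  rewrite (enorm_eq0 rw0) g00 mul0e integral0_eq// => z _.
  by rewrite /G /= g00 mulr0.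
have rw : 0 < r w by rewrite lt_def rw0 enorm_ge0.
have mS : measurable_fun setT ((fun v => (shell (r v))%:E) : 'rV[K]_n -> \bar K).
  apply/measurable_EFinP; exact: measurableT_comp measurable_shell measurable_enorm.
have S0 v : (0 <= (shell (r v))%:E)%E by rewrite lee_fin shell_ge0.
transitivity (\int[mu]_z (((r w)^-1 ^+ n * g w)%:E * (shell (r ((r w)^-1 *: z)))%:E))%E.
  apply: eq_integral => z _; rewrite /G /= -EFinM enormZ ger0_norm//.
  by rewrite mulrAC (mulrC (r z)).
rewrite ge0_integralZl//; last 2 first.
- apply: (measurableT_comp mS); apply: measurable_scale;
  exact: measurable_cst || exact: measurable_id.
- by rewrite lee_fin mulr_ge0// exprn_ge0.
rewrite (scale0 _ (fun v => (shell (r v))%:E))// ?invr_gt0// -/shell_mass muleA -EFinM.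
by congr (_%:E * _)%E; rewrite mulrAC mulfV ?mul1r// expf_neq0// invr_neq0.
Qed.

(** An inequality between integrals of radial profiles, valid in every
    direction, is integrated over the directions. *)
Lemma ge0_integral_le_of_rays (g1 g2 : 'rV[K]_n -> K) :
  measurable_fun setT (g1 : _ -> measurableTypeR K) ->
  measurable_fun setT (g2 : _ -> measurableTypeR K) ->
  (forall x, 0 <= g1 x) -> (forall x, 0 <= g2 x) -> g1 0 = 0 -> g2 0 = 0 ->
  (forall w, r w = 1 ->
    (\int[mu]_x (g1 (r x *: w))%:E <= \int[mu]_x (g2 (r x *: w))%:E)%E) ->
  (\int[mu]_x (g1 x)%:E <= \int[mu]_x (g2 x)%:E)%E.
Proof.
move=> m1 m2 g10 g20 g1_0 g2_0 le_rays.
rewrite -(lee_pmul2l shell_mass_fin shell_mass_gt0) -!polar_integral//.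
have weight_ge0 y : 0 <= (r y)^-1 ^+ (n + n) * shell (r y)^-1.
  by rewrite mulr_ge0 ?shell_ge0// exprn_ge0// invr_ge0 enorm_ge0.
have measurable_rays g : measurable_fun setT (g : _ -> measurableTypeR K) ->
    (forall x, 0 <= g x) -> measurable_fun setT (fun y =>
      ((r y)^-1 ^+ (n + n) * shell (r y)^-1)%:E *
      \int[mu]_x (g (r x *: ((r y)^-1 *: y)))%:E)%E.
  move=> mg g0; apply: emeasurable_funM.
    apply/measurable_EFinP; apply: measurable_funM.
      by apply: measurable_funX; exact: measurable_enormV.
    exact: (measurableT_comp measurable_shell measurable_enormV).
  pose F (p : 'rV[K]_n * 'rV[K]_n) := (g (r p.1 *: ((r p.2)^-1 *: p.2)))%:E.
  apply: (measurable_fun_fubini_tonelli_G (m1 := mu) F) => [|p].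
    apply/measurable_EFinP; apply: (measurableT_comp mg); apply: measurable_scale.
      exact: measurableT_comp measurable_enorm measurable_fst.
    apply: measurable_scale; last exact: measurable_snd.
    exact: measurableT_comp measurable_enormV measurable_snd.
  by rewrite lee_fin.
apply: ge0_le_integral => //.
- move=> y _; rewrite mule_ge0 ?lee_fin ?weight_ge0// integral_ge0// => x _.
  by rewrite lee_fin.
- exact: measurable_rays.
- exact: measurable_rays.
move=> y _; have [ry0|ry0] := eqVneq (r y) 0.
  by rewrite ry0 invr0 shell0 mulr0 !mul0e.
apply: lee_wpmul2l; first by rewrite lee_fin.
by apply: le_rays; rewrite enormZ normfV ger0_norm ?enorm_ge0// mulVf.
Qed.

End polar_average.

(** * Test functions of a punctured ball *)

Section test_functions.
Context {K : realType} {n : nat}.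
Implicit Types (f : 'rV[K]_n -> K) (x : 'rV[K]_n).

Lemma test_function_annular (R : \bar K) f : (0 < R)%E ->
  test_function (eball R `\ 0) f ->
  exists a b, [/\ 0 < a, (b%:E < R)%E & annular a b f].
Proof.
move=> R0 [sf cf fR]; set S := closure _ in cf fR.
have fS x : f x != 0 -> S x by move=> fx; exact: subset_closure.
have [S0|S0] := pselect (S !=set0); last first.
  exists 1, 0; split => //; split => // x fx; exfalso; apply: S0.
  by exists x; exact: fS.
have ce : {within S, continuous (@enorm K n)}.
  by apply: continuous_subspaceT; exact: continuous_enorm.
have [c cS cmin] := compact_EVT_min S0 cf ce.
have [d dS dmax] := compact_EVT_max S0 cf ce.
rewrite inE in cS; rewrite inE in dS.
have [_ c0] := fR c cS; have [dR _] := fR d dS.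
exists (enorm c), (enorm d); split => //.
  by rewrite lt_def enorm_ge0 andbT; apply/eqP => /enorm_eq0.
by split => // x /fS xS; rewrite cmin ?dmax// inE.
Qed.

Lemma annular_test_function (R : \bar K) (a b : K) f :
  0 < a -> (b%:E < R)%E -> annular a b f -> test_function (eball R `\ 0) f.
Proof.
move=> a0 bR af; have sf := annular_smooth af.
have Sab : closure [set x | f x != 0] `<=` [set x | a <= enorm x <= b].
  move=> x Sx; apply/negP => /negP /near_notin_annulus xab.
  have [y [fy]] := Sx _ xab.
  by rewrite (annular_support af fy).
split => //.
- apply: (subclosed_compact _ (@compact_box K n b)); first exact: closed_closure.
  move=> x /Sab /andP[_ xb] i.
  exact: le_trans (coord_le_enorm x i) xb.
- move=> x /Sab /andP[ax xb]; split.
    by rewrite /eball /= (le_lt_trans _ bR)// lee_fin.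
  move=> x0; move: ax; rewrite x0 leNgt.
  suff -> : enorm (0 : 'rV[K]_n) = 0 by rewrite a0.
  by rewrite /enorm big1 ?sqrtr0// => i _; rewrite mxE expr0n.
Qed.

Lemma integral_eball (R : \bar K) (a b : K) (h : 'rV[K]_n -> K) :
  (b%:E < R)%E -> (forall x, h x != 0 -> a <= enorm x <= b) ->
  (\int[lebesgue_rV n]_(x in eball R) (h x)%:E = \int[lebesgue_rV n]_x (h x)%:E)%E.
Proof.
move=> bR hab; rewrite integral_mkcond; congr (integral _ _ _).
apply/funext => x; rewrite patchE; case: ifPn => // /negP xR.
congr EFin; apply/esym/eqP; apply: contra_notT xR => /hab/andP[_ xb].
by rewrite inE /eball /= (le_lt_trans _ bR)// lee_fin.
Qed.

(** [W] is unconstrained outside [(0, R)], but there the test function vanishes in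
    a neighbourhood. *)
Lemma continuous_potential (R : \bar K) (a b : K) (W : K -> K) f :
  0 < a -> (b%:E < R)%E -> smooth_on_interval R W -> annular a b f ->
  continuous (fun x => W (enorm x) * f x ^+ 2).
Proof.
move=> a0 bR sW af x; have [xab|xab] := boolP (a <= enorm x <= b); last first.
  apply: continuous_near0.
  apply: filterS (vanish_near0 (annular_support af) xab) => y <-.
  by rewrite expr0n mulr0.
have /andP[ax xb] := xab.
apply: (@continuousM _ _ (fun y => W (enorm y)) (fun y => f y ^+ 2)).
  apply: (@continuous_comp _ _ _ (@enorm K n) W); first exact: continuous_enorm.
  apply/differentiable_continuous/derivable1_diffP.
  apply: (sW 0%N); first exact: lt_le_trans ax.
  by rewrite (le_lt_trans _ bR)// lee_fin.
apply: (@continuous_comp _ _ _ f (fun t : K => t ^+ 2)).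
  exact: smooth_continuous (annular_smooth af) x.
exact: exprn_continuous.
Qed.

(** Adding a common integrable function turns an inequality between signed
    integrands into one between nonnegative integrands. *)
Lemma le_integral_shift (b : K) (g h k : 'rV[K]_n -> K) :
  continuous g -> continuous h -> continuous k ->
  (forall x, g x != 0 -> box b x) -> (forall x, h x != 0 -> box b x) ->
  (forall x, k x != 0 -> box b x) ->
  (\int[lebesgue_rV n]_x (k x + g x)%:E <= \int[lebesgue_rV n]_x (k x + h x)%:E)%E =
  (\int[lebesgue_rV n]_x (g x)%:E <= \int[lebesgue_rV n]_x (h x)%:E)%E.
Proof.
move=> cg ch ck bg bh bk.
have ig := integrable_continuous_box cg bg.
have ih := integrable_continuous_box ch bh.
have ik := integrable_continuous_box ck bk.
under eq_integral do rewrite EFinD.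
under [X in (_ <= X)%E]eq_integral do rewrite EFinD.
rewrite !integralD_EFin//.
by rewrite leeD2lE// integrable_fin_num.
Qed.

End test_functions.

(** * Reduction to radial functions *)

Unset Implicit Arguments.

Theorem theorem1p13 (K : realType) (N : nat) (R : \bar K) (W : K -> K)
    (hN : (3 <= N)%N) (hR : (0 < R)%E) (hW : smooth_on_interval R W) :
  (forall u : 'rV[K]_N -> K, test_function (eball R `\ 0) u ->
    (\int[lebesgue_rV N]_(x in eball R) (`|laplacian u x| ^+ 2)%:E >=
     \int[lebesgue_rV N]_(x in eball R) (W (enorm x) * `|u x| ^+ 2)%:E)%E)
  <->
  (forall u : 'rV[K]_N -> K, test_function (eball R `\ 0) u -> radial u ->
    (\int[lebesgue_rV N]_(x in eball R) (`|laplacian u x| ^+ 2)%:E >=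
     \int[lebesgue_rV N]_(x in eball R) (W (enorm x) * `|u x| ^+ 2)%:E)%E).
Proof.
split=> [H u tu _|H u tu]; first exact: H.
have [a [b [a0 bR au]]] := test_function_annular hR tu.
have n0 : (0 < N)%N by exact: leq_trans hN.
have sqr_norm (t : K) : `|t| ^+ 2 = t ^+ 2 by rewrite real_normK// num_real.
have annular_sqr (f : 'rV[K]_N -> K) : annular a b f -> annular a b (fun x => f x ^+ 2).
  move=> af; rewrite (_ : (fun x => _) = fun x => f x * f x).
    exact: annularM (annular_smooth af) af.
  by apply/funext => x; rewrite expr2.
have WK (f : 'rV[K]_N -> K) x : annular a b f -> W (enorm x) * f x ^+ 2 != 0 ->
    a <= enorm x <= b.
  move=> af; rewrite mulf_eq0 negb_or expf_eq0/= => /andP[_].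
  exact: annular_support.
have reduce (f : 'rV[K]_N -> K) : annular a b f ->
    ((\int[lebesgue_rV N]_(x in eball R) (`|laplacian f x| ^+ 2)%:E >=
      \int[lebesgue_rV N]_(x in eball R) (W (enorm x) * `|f x| ^+ 2)%:E)%E =
     (\int[lebesgue_rV N]_x (lap f x ^+ 2)%:E >=
      \int[lebesgue_rV N]_x (W (enorm x) * f x ^+ 2)%:E)%E).
  move=> af; rewrite laplacianE.
  under eq_integral do rewrite sqr_norm.
  under [X in (_ <= X)%E]eq_integral do rewrite sqr_norm.
  rewrite (integral_eball bR (fun x => @WK f x af)).
  by rewrite (integral_eball bR (annular_support (annular_sqr _ (annular_lap af)))).
rewrite (reduce u au).
have aLu := annular_div_sqn a0 (annular_radial_part au).
apply: (@le_trans _ _ (\int[lebesgue_rV N]_x (div_sqn (radial_part u) x ^+ 2)%:E)%E); last first.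
  rewrite -(EFin_total (annular_sqr _ aLu)) -(EFin_total (annular_sqr _ (annular_lap au))).
  by rewrite lee_fin; exact: (rellich_radial_part a0 hN au).
pose V x := W (enorm x) * u x ^+ 2.
pose G x := div_sqn (radial_part u) x ^+ 2.
have cV : continuous V by exact: (continuous_potential a0 bR hW au).
have cG : continuous G by exact: smooth_continuous (annular_smooth (annular_sqr _ aLu)).
have cA : continuous (fun x => `|V x|).
  by move=> x; apply: (@continuous_comp _ _ _ V (fun t : K => `|t|));
    [exact: cV|exact: norm_continuous].
have annulus_box (x : 'rV[K]_N) : a <= enorm x <= b -> box b x.
  by move=> /andP[_ xb] i; exact: le_trans (coord_le_enorm x i) xb.
have bV x : V x != 0 -> box b x by move=> /(WK _ _ au); exact: annulus_box.
have bG x : G x != 0 -> box b x.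
  by move=> /(annular_support (annular_sqr _ aLu)); exact: annulus_box.
have bA x : `|V x| != 0 -> box b x by rewrite normr_eq0; exact: bV.
have zero_out : ~~ (a <= enorm (0 : 'rV[K]_N) <= b).
  rewrite negb_and -ltNge /enorm big1 ?sqrtr0 ?a0// => i _.
  by rewrite mxE expr0n.
have u0 := annular_eq0 au zero_out.
have Lu0 := annular_eq0 aLu zero_out.
(* The potential term is signed: [|V|] is added to both sides before averaging. *)
rewrite -(le_integral_shift cV cG cA bV bG bA).
apply: (ge0_integral_le_of_rays n0).
- by apply: continuous_measurable_rV; apply: continuous_addr; [exact: cA|exact: cV].
- by apply: continuous_measurable_rV; apply: continuous_addr; [exact: cA|exact: cG].
- by move=> x; rewrite -lerBlDr sub0r -normrN ler_norm.
- by move=> x; rewrite addr_ge0 ?sqr_ge0.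
- by rewrite /V u0 expr0n mulr0 normr0 addr0.
- by rewrite /V /G u0 Lu0 !expr0n mulr0 normr0 addr0.
move=> w w1.
have ar := annular_ray a0 w1 au.
have radial_ray : radial (ray w u) by exists (fun t => u (t *: w)).
have := H _ (annular_test_function a0 bR ar) radial_ray.
rewrite (reduce _ ar).
pose Vr x := W (enorm x) * ray w u x ^+ 2.
pose Gr x := lap (ray w u) x ^+ 2.
have VE x : V (enorm x *: w) = Vr x by rewrite /V /Vr enorm_ray.
have GE x : G (enorm x *: w) = Gr x by rewrite /Gr (lap_ray a0 w1 _ au).
have cVr : continuous Vr by exact: (continuous_potential a0 bR hW ar).
have alr := annular_sqr _ (annular_lap ar).
have cGr : continuous Gr by exact: smooth_continuous (annular_smooth alr).
have cAr : continuous (fun x => `|Vr x|).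
  by move=> x; apply: (@continuous_comp _ _ _ Vr (fun t : K => `|t|));
    [exact: cVr|exact: norm_continuous].
have bVr x : Vr x != 0 -> box b x by move=> /(WK _ _ ar); exact: annulus_box.
have bGr x : Gr x != 0 -> box b x by move=> /(annular_support alr); exact: annulus_box.
have bAr x : `|Vr x| != 0 -> box b x by rewrite normr_eq0; exact: bVr.
under [X in _ -> (X <= _)%E]eq_integral do rewrite VE.
under [X in _ -> (_ <= X)%E]eq_integral do rewrite VE GE.
by move=> le_r; rewrite (le_integral_shift cVr cGr cAr bVr bGr bAr).
Qed.
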